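(* Let $0<p<\infty$ and $0<q\le\infty$. Let $(X,\mathcal A)$ denote either the pair $(\mathcal Q_{p,q},\ \mathcal A(p,q,\infty)^S)$ or the pair $(\mathcal P_{p,q},\ \mathcal A(p,q,\infty)^* )$. The following holds in both cases. (i) If $f=(f_n)_{n\ge 0}\in\mathcal M$ is in $X$, then there exists a sequence of triplets $(\lambda_k,a^k,\nu^k)_{k\in\mathbb Z}\in\mathcal A$ such that for any $n\in\mathbb N$ $$\sum_{k\in\mathbb Z}\lambda_k\,\mathbb E_n a^k=f_n\quad\text{a.e.},$$ and for every $0<\eta\le 1$ $$\left\|\sum_{k\in\mathbb Z}\left(\frac{\lambda_k}{\mathbb P(B_{\nu^k})^{1/p}}\right)^{\eta}\mathbf 1_{B_{\nu^k}}\right\|^{1/\eta}_{\frac p\eta,\frac q\eta}\le C\,\|f\|_{X},$$ where $C>0$ is a constant depending only on $p,q,\eta$. Moreover, $\sum_{k=l}^m\lambda_k a^k\to f$ in $X$ as $m\to\infty$, $l\to-\infty$. (ii) Conversely, if $f\in\mathcal M$ has a decomposition $f_n=\sum_{k\in\mathbb Z}\lambda_k\mathbb E_na^k$ a.e. for all $n\in\mathbb N$, with $(\lambda_k,a^k,\nu^k)_{k\in\mathbb Z}\in\mathcal A$, then for every $0<\eta\le1$ $$\|f\|_{X}\le C\left\|\sum_{k\in\mathbb Z}\left(\frac{\lambda_k}{\mathbb P(B_{\nu^k})^{1/p}}\right)^{\eta}\mathbf 1_{B_{\nu^k}}\right\|^{1/\eta}_{\frac p\eta,\frac q\eta},$$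 where $C>0$ is a constant depending only on $p,q,\eta$.
   Context: Setting. $(\Omega,\mathcal F,\mathbb P)$ is a probability space, $(\mathcal F_n)_{n\ge0}$ is a non-decreasing sequence of sub-$\sigma$-algebras with $\sigma(\bigcup_n\mathcal F_n)=\mathcal F$, and $\{\Omega_j\}_{j\in\mathbb Z}$ is a fixed sequence of nonempty, pairwise disjoint, measurable subsets of $\Omega$ with $\bigcup_j\Omega_j=\Omega$. $\mathbb E_n$ is conditional expectation with respect to $\mathcal F_n$. $\mathbf 1_A$ is the indicator of $A$. Amalgam spaces. For $0<p<\infty$ and $0<q<\infty$, $\|f\|_{p,q}=\Big[\sum_{j\in\mathbb Z}\big(\int_\Omega|f|^p\mathbf 1_{\Omega_j}\,d\mathbb P\big)^{q/p}\Big]^{1/q}$, and $\|f\|_{p,\infty}=\sup_{j\in\mathbb Z}\big(\int_\Omega|f|^p\mathbf 1_{\Omega_j}\,d\mathbb P\big)^{1/p}$. $L_{p,q}$ is the space of measurable $f$ with $\|f\|_{p,q}<\infty$. When $q=\infty$, $q/\eta=\infty$. Martingales. $\mathcal M$ is the set of all martingales $f=(f_n)_{n\ge0}$ with respect to $(\mathcal F_n)$ with $f_0=0$. Put $d_nf=f_n-f_{n-1}$ for $n\ge1$, $d_0f=0$, $S_n(f)=\big(\sum_{i=1}^n|d_if|^2\big)^{1/2}$, $S(f)=\big(\sum_{n\ge1}|d_nf|^2\big)^{1/2}$ and $f^*=\sup_n|f_n|$. An integrable function $a$ is identified with the martingale $(\mathbb E_na)_{n\ge0}$; $S(a)$ and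 $a^*$ are defined accordingly. Spaces. $\Gamma$ is the set of sequences $\beta=(\beta_n)_{n\ge0}$ of non-negative functions, non-decreasing in $n$, with $\beta_n$ $\mathcal F_n$-measurable; $\beta_\infty=\lim_n\beta_n$. $\mathcal Q_{p,q}$ is the space of $f\in\mathcal M$ for which there is $\beta\in\Gamma$ with $S_n(f)\le\beta_{n-1}$ for all $n\ge1$ and $\beta_\infty\in L_{p,q}$; $\|f\|_{\mathcal Q_{p,q}}$ is the infimum of $\|\beta_\infty\|_{p,q}$ over all such $\beta$. $\mathcal P_{p,q}$ and $\|f\|_{\mathcal P_{p,q}}$ are defined in the same way with the condition $|f_n|\le\beta_{n-1}$ for all $n\ge1$ in place of $S_n(f)\le\beta_{n-1}$. Atoms. $\mathcal T$ is the set of stopping times (with values in $\mathbb Z_+\cup\{\infty\}$), and $B_\nu=\{\nu\ne\infty\}$ for $\nu\in\mathcal T$. A measurable function $a$ is a $(p,\infty)^S$-atom (resp. $(p,\infty)^*$-atom) if there is $\nu\in\mathcal T$ such that (a1) $\mathbb E_na=0$ on $\{\nu\ge n\}$ for every $n$; (a2) $\|S(a)\|_\infty\le\mathbb P(B_\nu)^{-1/p}$ (resp. $\|a^*\|_\infty\le\mathbb P(B_\nu)^{-1/p}$). $\mathcal A(p,q,\infty)^S$ (resp. $\mathcal A(p,q,\infty)^*$) is the set of all sequences of triplets $(\lambda_k,a^k,\nu^k)$ where $\lambda_k\ge0$ are numbers, $a^k$ are $(p,\infty)^S$-atoms (resp. $(p,\infty)^*$-atoms) and $\nu^k\in\mathcal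 T$ is a stopping time for which $a^k$ satisfies (a1) and (a2), such that for any $0<\eta\le1$, $\sum_k\big(\lambda_k/\mathbb P(B_{\nu^k})^{1/p}\big)^\eta\mathbf 1_{B_{\nu^k}}\in L_{\frac p\eta,\frac q\eta}$. Convention: if $\mathbb P(B_\nu)=0$, an atom associated with $\nu$ is $0$ a.e. and the corresponding term in these sums is $0$.
   Formalization: The convergence of the partial sums to f in X (''Moreover'' in (i)) is asserted only for q < ∞; for q = ∞ it is false in general, e.g. when infinitely many Ω_j have positive probability and f takes values ±P(Ω_j)^{-1/p} on Ω_j. *)

(* Defs.v *)
From HB Require Import structures.
From mathcomp Require Import all_boot all_order all_algebra.
From mathcomp Require Import all_classical all_reals all_analysis.
From mathcomp Require Import measurable_realfun ess_sup_inf hoelder.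

Set Implicit Arguments.
Unset Strict Implicit.
Unset Printing Implicit Defensive.

Import Order.TTheory GRing.Theory Num.Theory.
Import numFieldNormedType.Exports.

Local Open Scope classical_set_scope.
Local Open Scope ring_scope.

(** * Filtrations, conditional expectation, martingales *)

Definition filtration d (T : measurableType d) (F : nat -> set (set T)) : Prop :=
  [/\ forall n, sigma_algebra setT (F n),
      forall n, F n `<=` measurable,
      forall m n, (m <= n)%N -> F m `<=` F n &
      <<s \bigcup_n F n >> = (measurable : set (set T))].

Definition measurable_wrt (R : realType) d (T : measurableType d)
    (G : set (set T)) (X : T -> R) : Prop :=
  measurable_fun setT (X : g_sigma_algebraType G -> R).

Definition is_cexp d (T : measurableType d) (R : realType) (P : probability T R)
    (G : set (set T)) (X Y : T -> R) : Prop :=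
  [/\ measurable_wrt G Y,
      P.-integrable setT (EFin \o Y) &
      forall A, G A ->
        (\int[P]_(x in A) (Y x)%:E = \int[P]_(x in A) (X x)%:E)%E].

(* A chosen version of E[X | G]; only meaningful when X is integrable.  All
   versions agree almost surely, and every use below is up to null sets. *)
Definition cexp d (T : measurableType d) (R : realType) (P : probability T R)
    (G : set (set T)) (X : T -> R) : T -> R :=
  xget (fun=> 0) [set Y | is_cexp P G X Y].

(* The martingale (E_n a)_n attached to an integrable function a. *)
Definition mart_of d (T : measurableType d) (R : realType) (P : probability T R)
    (F : nat -> set (set T)) (a : T -> R) : nat -> T -> R :=
  fun n => cexp P (F n) a.

Definition martingale0 d (T : measurableType d) (R : realType)
    (P : probability T R) (F : nat -> set (set T)) (f : nat -> T -> R) : Prop :=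
  [/\ forall n, measurable_wrt (F n) (f n),
      forall n, P.-integrable setT (EFin \o f n),
      forall n, {ae P, forall x, cexp P (F n) (f n.+1) x = f n x} &
      {ae P, forall x, f 0%N x = 0}].

(** * Square function and maximal function *)

Definition mdiff (R : realType) T (f : nat -> T -> R) (n : nat) (x : T) : R :=
  if n is m.+1 then f m.+1 x - f m x else 0.

Definition sqfun_n (R : realType) T (f : nat -> T -> R) (n : nat) (x : T) : R :=
  Num.sqrt (\sum_(1 <= i < n.+1) `|mdiff f i x| ^+ 2).

Definition sqfun (R : realType) T (f : nat -> T -> R) (x : T) : \bar R :=
  ((\sum_(1 <= i <oo) (`|mdiff f i x| ^+ 2)%:E) `^ 2^-1)%E.

Definition maxfun (R : realType) T (f : nat -> T -> R) (x : T) : \bar R :=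
  ereal_sup (range (fun n => `|f n x|%:E)).

(** * Amalgam spaces *)

Definition amalgam_partition d (T : measurableType d) (Om : int -> set T) : Prop :=
  [/\ forall j, Om j !=set0,
      forall j, measurable (Om j),
      trivIset setT Om &
      \bigcup_j Om j = setT].

(* q ranges over ]0, +oo]; the branch q = -oo is never used. *)
Definition amalgam_norm d (T : measurableType d) (R : realType)
    (P : probability T R) (Om : int -> set T) (p : R) (q : \bar R)
    (f : T -> \bar R) : \bar R :=
  (match q with
   | r%:E => (\esum_(j in [set: int])
                (\int[P]_(x in Om j) (`|f x| `^ p)) `^ (r / p)) `^ r^-1
   | _ => ereal_sup (range (fun j : int =>
                (\int[P]_(x in Om j) (`|f x| `^ p)) `^ p^-1))
   end)%E.

Definition amalgam_space d (T : measurableType d) (R : realType)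
    (P : probability T R) (Om : int -> set T) (p : R) (q : \bar R)
    : set (T -> \bar R) :=
  [set f : T -> \bar R | measurable_fun setT f /\ (amalgam_norm P Om p q f < +oo)%E].

(** * The spaces Q_{p,q} and P_{p,q} *)

(* [Square] selects the pair (Q_{p,q}, A(p,q,oo)^S), [Maximal] the pair
   (P_{p,q}, A(p,q,oo)^* ). *)
Variant hardy_kind := Square | Maximal.

Definition predictable_seq (R : realType) d (T : measurableType d) (F : nat -> set (set T))
    (b : nat -> T -> R) : Prop :=
  [/\ forall n x, 0 <= b n x,
      forall n x, b n x <= b n.+1 x &
      forall n, measurable_wrt (F n) (b n)].

Definition seq_limit (R : realType) T (b : nat -> T -> R) (x : T) : \bar R :=
  limn (fun n => (b n x)%:E).

Definition dominates d (T : measurableType d) (R : realType)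
    (P : probability T R) (k : hardy_kind) (f b : nat -> T -> R) : Prop :=
  match k with
  | Square => forall n, {ae P, forall x, sqfun_n f n.+1 x <= b n x}
  | Maximal => forall n, {ae P, forall x, `|f n.+1 x| <= b n x}
  end.

Definition admissible d (T : measurableType d) (R : realType)
    (P : probability T R) (F : nat -> set (set T)) (Om : int -> set T)
    (k : hardy_kind) (p : R) (q : \bar R) (f : nat -> T -> R)
    : set (nat -> T -> R) :=
  [set b | [/\ predictable_seq F b, dominates P k f b &
               amalgam_space P Om p q (seq_limit b)]].

Definition hardy_space d (T : measurableType d) (R : realType)
    (P : probability T R) (F : nat -> set (set T)) (Om : int -> set T)
    (k : hardy_kind) (p : R) (q : \bar R) : set (nat -> T -> R) :=
  [set f | martingale0 P F f /\ admissible P F Om k p q f !=set0].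

Definition hardy_norm d (T : measurableType d) (R : realType)
    (P : probability T R) (F : nat -> set (set T)) (Om : int -> set T)
    (k : hardy_kind) (p : R) (q : \bar R) (f : nat -> T -> R) : \bar R :=
  ereal_inf [set amalgam_norm P Om p q (seq_limit b) |
             b in admissible P F Om k p q f].

(** * Stopping times and atoms *)

(* [None] is the value oo. *)
Definition stopping_time T (F : nat -> set (set T)) (nu : T -> option nat) : Prop :=
  forall n, F n [set x | exists2 m, nu x = Some m & (m <= n)%N].

Definition stop_fin T (nu : T -> option nat) : set T := [set x | nu x <> None].

Definition stop_ge T (nu : T -> option nat) (n : nat) : set T :=
  [set x | forall m, nu x = Some m -> (n <= m)%N].

Definition atom_fun (R : realType) T (k : hardy_kind) (f : nat -> T -> R)
    : T -> \bar R :=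
  match k with Square => sqfun f | Maximal => maxfun f end.

(* If P (B_nu) = 0 then 0 `^ (- p^-1) = 0 in the library, so the size condition
   reads a = 0 a.e., which is the usual convention for such stopping times. *)
Definition is_atom d (T : measurableType d) (R : realType) (P : probability T R)
    (F : nat -> set (set T)) (k : hardy_kind) (p : R) (a : T -> R)
    (nu : T -> option nat) : Prop :=
  [/\ stopping_time F nu,
      P.-integrable setT (EFin \o a),
      forall n, {ae P, forall x, stop_ge nu n x -> cexp P (F n) a x = 0} &
      (Lnorm P +oo (atom_fun k (mart_of P F a))
         <= (P (stop_fin nu)) `^ (- p^-1))%E].

(* When P (B_{nu^k}) = 0 the k-th term is 0, since 0^-1 = 0. *)
Definition atom_sum d (T : measurableType d) (R : realType) (P : probability T R)
    (p eta : R) (lam : int -> R) (nu : int -> T -> option nat) (x : T) : \bar R :=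
  (\esum_(k in [set: int])
     (((lam k / (fine (P (stop_fin (nu k))) `^ p^-1)) `^ eta)%R
        * \1_(stop_fin (nu k)) x)%:E)%E.

Definition atomic_triplets d (T : measurableType d) (R : realType)
    (P : probability T R) (F : nat -> set (set T)) (Om : int -> set T)
    (k : hardy_kind) (p : R) (q : \bar R)
    (lam : int -> R) (a : int -> T -> R) (nu : int -> T -> option nat) : Prop :=
  [/\ forall i, 0 <= lam i,
      forall i, is_atom P F k p (a i) (nu i) &
      forall eta, 0 < eta <= 1 ->
        amalgam_space P Om (p / eta) (q * (eta^-1)%:E)%E
          (atom_sum P p eta lam nu)].

(* || sum_k (lam_k / P(B_{nu^k})^{1/p})^eta 1_{B_{nu^k}} ||_{p/eta,q/eta}^{1/eta} *)
Definition atomic_norm d (T : measurableType d) (R : realType)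
    (P : probability T R) (Om : int -> set T) (p : R) (q : \bar R) (eta : R)
    (lam : int -> R) (nu : int -> T -> option nat) : \bar R :=
  (amalgam_norm P Om (p / eta)%R (q * (eta^-1)%:E) (atom_sum P p eta lam nu)
     `^ eta^-1)%E.

(** * Series indexed by the integers *)

(* The partial sum over the integers from - lm.1 to lm.2. *)
Definition zsum (V : zmodType) (u : int -> V) (lm : nat * nat) : V :=
  \sum_(i < (lm.1 + lm.2).+1) u (i%:Z - lm.1%:Z).

(* Both ends of the range of summation go to infinity, independently. *)
Definition two_sided : set_system (nat * nat) := filter_prod \oo \oo.

Definition atomic_decomposition d (T : measurableType d) (R : realType)
    (P : probability T R) (F : nat -> set (set T))
    (lam : int -> R) (a : int -> T -> R) (f : nat -> T -> R) : Prop :=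
  forall n, {ae P, forall x,
    zsum (fun k => lam k * cexp P (F n) (a k) x) @ two_sided --> f n x}.

(* Pitfall: for q = +oo such norm convergence fails in general, whatever the
   triplets.  A finite sum g of atoms has S(g) and g^* essentially bounded, while
   S(f) may equal P(Om j)^{-1/p} on each Om j; then S(f - g) >= S(f) - c on every
   Om j, and ||f - g|| >= sup_j (1 - c P(Om j)^{1/p}) = 1 as soon as infinitely
   many Om j have positive probability. *)
Definition atomic_convergence d (T : measurableType d) (R : realType)
    (P : probability T R) (F : nat -> set (set T)) (Om : int -> set T)
    (k : hardy_kind) (p : R) (q : \bar R)
    (lam : int -> R) (a : int -> T -> R) (f : nat -> T -> R) : Prop :=
  (fun lm => hardy_norm P F Om k p q
     (fun n x =>
        f n x - mart_of P F (fun y => zsum (fun i => lam i * a i y) lm) n x))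
    @ two_sided --> 0%E.

(* Main.v *)
Require Import Defs.
From HB Require Import structures.
From mathcomp Require Import all_boot all_order all_algebra.
From mathcomp Require Import all_classical all_reals all_analysis.
From mathcomp Require Import measurable_realfun ess_sup_inf hoelder.
From mathcomp Require Import zify ring lra.
Import Order.TTheory GRing.Theory Num.Theory.
Import numFieldNormedType.Exports.
Local Open Scope classical_set_scope.
Local Open Scope ring_scope.

Set Implicit Arguments.
Unset Strict Implicit.
Unset Printing Implicit Defensive.

(** Both pairs are treated at once: S_n(f) and |f_n| are seminorms of the increments d_1 f, ..., d_n
    f, unified as [ksize], and the decisive feature is that beta bounds time n by a quantity known
    at time n - 1.

    Part (i). Take an admissible beta of minimal norm ([hardy_norm_attained]) and let nu^k be the
    first n with beta_n > 2^k. Because of the one-step lead of beta, f stopped at nu^k still has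
    size at most 2^k ([ksize_trunc]). The increments d_{i+1} f with 2^k < beta_i <= 2^(k+1)
    therefore form a martingale, f stopped at nu^{k+1} minus f stopped at nu^k, of size at most 4
    2^k. It is bounded in L^2, hence it is the martingale of an integrable function
    ([closed_martingale_ae]), and it vanishes up to time nu^k. Division by lambda_k = 4 2^k
    P(B_{nu^k})^{1/p} gives the atom a^k. Since B_{nu^k} = {beta_oo > 2^k}, the sum in the norm
    estimate is dominated by a geometric series, at most a constant times beta_oo^eta ([dyadic_sum],
    [atom_sum_le]), and [amalgam_norm_poweR] turns this into the bound by the norm of beta_oo. The
    bands telescope over k. What is left of f after finitely many of them has a predictable majorant
    whose limit is at most 3 beta_oo and tends to 0 wherever beta_oo is finite. For finite q,
    dominated convergence on each Omega_j and then in the sum over j ([amalgam_norm_cvg0]) gives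
    convergence in X.

    Part (ii). The martingale of a^k vanishes up to time nu^k, so its contribution at time n is at
    most c_k = lambda_k / P(B_{nu^k})^{1/p}, and it is 0 unless nu^k <= n - 1. Thus beta_n, the sum
    of the c_k with nu^k <= n, is a predictable majorant of f ([synthesis_dominates]). The
    inequality between l^1 and l^eta sums for eta <= 1 ([esum_le_poweR]) bounds beta_oo by the power
    1/eta of the atomic sum, so the constant is 1. *)

(** * Existence, uniqueness and linearity of conditional expectations *)

Section conditional_expectation.
Context d (T : measurableType d) (R : realType) (P : probability T R).
Variable G : set (set T).
Hypothesis (sG : sigma_algebra setT G) (GF : G `<=` measurable).
Local Notation T' := (g_sigma_algebraType G).
Implicit Types X Y : T -> R.

Lemma measurable_g_sigmaE : (measurable : set (set T')) = G.
Proof. exact: sigma_algebra_id. Qed.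

Lemma measurable_id_g_sigma : measurable_fun [set: T] (id : T -> T').
Proof. by move=> _ A mA; rewrite setTI; apply: GF; rewrite -measurable_g_sigmaE. Qed.

Lemma measurable_wrtW Y : measurable_wrt G Y -> measurable_fun setT Y.
Proof.
by move=> mY _ A mA; have := mY measurableT _ mA; rewrite measurable_g_sigmaE; exact: GF.
Qed.

(** Radon-Nikodym on the measurable space (T, G): pushing [P] and the charge A |-> int_A X forward
    along the identity restricts both to [G], so the derivative is [G]-measurable. *)
Lemma cexpP X : P.-integrable setT (EFin \o X) -> is_cexp P G X (cexp P G X).
Proof.
move=> iX; rewrite /cexp; apply: xgetPex.
have mid := measurable_id_g_sigma.
pose idf := mfun_Sub (mem_set mid : (id : T -> T') \in mfun).
pose Q := distribution P idf.
pose nu := measure_function_pushforward__canonical__charge_Charge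
  (induced_charge iX) mid.
have nuQ : nu `<< Q.
  apply/null_content_dominatesP => A mA QA.
  rewrite /nu/= /pushforward /induced_charge/=; apply: null_set_integral => //.
  - by apply: GF; rewrite -measurable_g_sigmaE.
  - by apply: measurable_funTS; exact: measurable_int iX.
have nuE A := @Radon_Nikodym_integral _ _ _ nu Q A nuQ.
have iD := @Radon_Nikodym_integrable _ _ _ nu Q nuQ.
have fD x := @Radon_Nikodym_fin_num _ _ _ nu Q x nuQ.
set D := Radon_Nikodym nu Q in nuE iD fD.
have DE : D = EFin \o (fine \o D) by apply/funext => x /=; rewrite fineK.
have mD : measurable_fun setT (D : T' -> _) := measurable_int _ iD.
have iPD : P.-integrable setT (EFin \o (fine \o D)).
  rewrite -DE; apply/integrableP; split.
    by move=> _ A mA; have := mD measurableT _ mA; rewrite measurable_g_sigmaE; exact: GF.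
  have /integrableP[_] := iD.
  rewrite ge0_integral_pushforward//.
  by apply: measurableT_comp.
exists (fine \o D); split => //.
  by apply/measurable_EFinP; rewrite -[X in measurable_fun _ X]/(EFin \o (fine \o D)) -DE.
move=> A GA.
have mA : measurable (A : set T') by rewrite measurable_g_sigmaE.
have := nuE A mA; rewrite {1}/nu/= /pushforward /induced_charge/= preimage_id => ->.
rewrite DE integral_pushforward//.
- by rewrite -DE.
- by apply: integrableS iPD => //; exact: GF.
Qed.

(** Two versions have the same integral over every set of [G], so they agree almost surely for the
    restriction of [P] to [G]; a null set found there is also null for [P]. *)
Lemma is_cexp_unique X Y Z : is_cexp P G X Y -> is_cexp P G X Z ->
  {ae P, forall x, Y x = Z x}.
Proof.
move=> [mY iY YX] [mZ iZ ZX].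
have mid := measurable_id_g_sigma.
pose idf := mfun_Sub (mem_set mid : (id : T -> T') \in mfun).
pose Q := distribution P idf.
have iQY : Q.-integrable setT (EFin \o Y).
  by apply: integrable_pushforward => //; exact/measurable_EFinP.
have [||N [mN N0 YZN]] := @integral_ae_eq _ T' R Q setT measurableT
  (EFin \o Z) (EFin \o Y) iQY.
- exact/measurable_EFinP.
- move=> E _ mE.
  have GE : G E by rewrite -measurable_g_sigmaE.
  rewrite !integral_pushforward//=.
  + by rewrite YX// ZX.
  + exact/measurable_EFinP.
  + by apply: integrableS iZ => //; exact: GF.
  + exact/measurable_EFinP.
  + by apply: integrableS iY => //; exact: GF.
exists N; split => //.
  by apply: GF; rewrite -measurable_g_sigmaE.
by move=> x YZ; apply: YZN => /= YZx; apply: YZ; have [] := YZx I.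
Qed.

Lemma measurable_wrt_lin (a b : R) Y Z : measurable_wrt G Y -> measurable_wrt G Z ->
  measurable_wrt G (fun x => a * Y x + b * Z x).
Proof. by move=> mY mZ; apply: measurable_funD; apply: measurable_funM. Qed.

Lemma is_cexp_lin (a b : R) X X' Y Y' :
  P.-integrable setT (EFin \o X) -> P.-integrable setT (EFin \o X') ->
  is_cexp P G X Y -> is_cexp P G X' Y' ->
  is_cexp P G (fun x => a * X x + b * X' x) (fun x => a * Y x + b * Y' x).
Proof.
move=> iX iX' [mY iY YX] [mY' iY' Y'X'].
have iZ c (W : T -> R) : P.-integrable setT (EFin \o W) ->
    P.-integrable setT (fun x => c%:E * (W x)%:E)%E by exact: integrableZl.
have intE A W W' : G A -> P.-integrable setT (EFin \o W) ->
    P.-integrable setT (EFin \o W') ->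
    (\int[P]_(x in A) (a * W x + b * W' x)%:E =
     a%:E * \int[P]_(x in A) (W x)%:E + b%:E * \int[P]_(x in A) (W' x)%:E)%E.
  move=> GA iW iW'; have mA := GF GA.
  under eq_integral do rewrite EFinD 2!EFinM.
  rewrite integralD//; try by apply: integrableS (iZ _ _ _).
  by rewrite !integralZl//; apply: integrableS (_ : P.-integrable setT _).
split.
- exact: measurable_wrt_lin.
- have -> : EFin \o (fun x => a * Y x + b * Y' x) =
     ((fun x => a%:E * (Y x)%:E) \+ (fun x => b%:E * (Y' x)%:E))%E by [].
  by apply: integrableD => //; exact: iZ.
- by move=> A GA; rewrite !intE// YX// Y'X'.
Qed.

Lemma is_cexp_aeq X X' Y : P.-integrable setT (EFin \o X) ->
  {ae P, forall x, X x = X' x} -> measurable_fun setT X' ->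
  is_cexp P G X Y -> is_cexp P G X' Y.
Proof.
move=> iX XX' mX' [mY iY YX]; split=> // A GA; rewrite YX//.
have mA := GF GA.
apply: ae_eq_integral => //.
- by apply: measurable_funTS; exact: measurable_int iX.
- by apply: measurable_funTS; exact/measurable_EFinP.
- by apply: filterS XX' => x /= ->.
Qed.

End conditional_expectation.

(** * Integrals against bounded measurable multipliers *)

Section pull_out.
Context d (T : measurableType d) (R : realType) (P : probability T R).
Implicit Types X Y Z W : T -> R.

Definition bounded_meas W :=
  measurable_fun setT W /\ exists K : R, forall x, `|W x| <= K.

Lemma bounded_meas_integrable W : bounded_meas W -> P.-integrable setT (EFin \o W).
Proof.
move=> [mW [K WK]]; apply: measurable_bounded_integrable => //.
- by rewrite -ge0_fin_numE// fin_num_measure.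
- by exists K; split; [exact: num_real | move=> M KM x _ /=; exact: le_trans (WK x) (ltW KM)].
Qed.

Lemma bounded_measD W W' : bounded_meas W -> bounded_meas W' ->
  bounded_meas (fun x => W x + W' x).
Proof.
move=> [mW [K WK]] [mW' [K' WK']]; split; first exact: measurable_funD.
by exists (K + K') => x; rewrite (le_trans (ler_normD _ _))// lerD.
Qed.

Lemma bounded_measM W W' : bounded_meas W -> bounded_meas W' ->
  bounded_meas (fun x => W x * W' x).
Proof.
move=> [mW [K WK]] [mW' [K' WK']]; split; first exact: measurable_funM.
by exists (K * K') => x; rewrite normrM ler_pM.
Qed.

Lemma bounded_meas_cst (c : R) : bounded_meas (fun=> c).
Proof. by split => //; exists `|c|. Qed.

Lemma bounded_meas_sum n (w : nat -> T -> R) : (forall i, bounded_meas (w i)) ->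
  bounded_meas (fun x => \sum_(i < n) w i x).
Proof.
move=> bw; elim: n => [|n IH].
  by under eq_fun do rewrite big_ord0; exact: bounded_meas_cst.
by under eq_fun do rewrite big_ord_recr; exact: bounded_measD.
Qed.

(** The sum counts the integers 1, ..., K that are at most t, so it is the integer part of t. *)
Lemma count_le_approx (K : nat) (t : R) : 0 <= t -> t <= K%:R ->
  `|t - \sum_(k < K) (k.+1%:R <= t)%R%:R| <= 1.
Proof.
move=> t0 tK.
suff [] : (K%:R <= t -> \sum_(k < K) (k.+1%:R <= t)%R%:R = K%:R :> R) /\
   (t < K%:R -> \sum_(k < K) (k.+1%:R <= t)%R%:R <= t
                <= \sum_(k < K) (k.+1%:R <= t)%R%:R + 1).
  move=> H1 H2; have [/H2 /andP[h1 h2]|/[dup] /H1 -> Kt] := ltP t K%:R.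
    by rewrite ger0_norm ?subr_ge0// lerBlDl.
  by rewrite (_ : t = K%:R) ?subrr ?normr0//; apply/eqP; rewrite eq_le tK Kt.
elim: {tK} K => [|K [IH1 IH2]]; rewrite ?big_ord0 ?big_ord_recr/=.
  by split=> // /lt_geF; rewrite t0.
split=> [Kt|tK].
  by rewrite Kt IH1 ?natr1//; apply: le_trans Kt; rewrite ler_nat.
rewrite (lt_geF tK) mulr0n addr0; have [/IH2//|/[dup] Kt /IH1 ->] := ltP t K%:R.
by rewrite Kt/= natr1 ltW.
Qed.

Variable G : set (set T).
Hypothesis (sG : sigma_algebra setT G) (GF : G `<=` measurable).

Lemma sub_measurable_ge Z (c : R) : measurable_wrt G Z -> G [set x | c <= Z x].
Proof.
move=> mZ; have := mZ measurableT _ (measurable_itv `[c, +oo[).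
by rewrite (measurable_g_sigmaE sG) setTI; congr G; apply/seteqP; split=> x /=;
  rewrite in_itv/= andbT.
Qed.

(** [Z] lies within 1/n of a staircase made of the indicators of {Z >= (k+1)/n}. Each of these sets
    is in [G], so [Y] integrates to 0 against the staircase, and |int Z Y| is at most (1/n) int |Y|
    for every n. *)
Let pull_out_pos Y Z (M : R) : P.-integrable setT (EFin \o Y) ->
  (forall A, G A -> \int[P]_(x in A) (Y x)%:E = 0)%E ->
  measurable_wrt G Z -> (forall x, 0 <= Z x <= M) ->
  (\int[P]_x (Z x * Y x)%:E = 0)%E.
Proof.
move=> iY Y0 mZ Z0M.
have mZ' := measurable_wrtW sG GF mZ.
have mY : measurable_fun setT Y by apply/measurable_EFinP; exact: measurable_int iY.
have iM W K : measurable_fun setT W -> (forall x, `|W x| <= K) ->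
    P.-integrable setT (EFin \o (fun x => W x * Y x)).
  move=> mW WK; apply: le_integrable (integrableZl _ (`|K|) iY) => //.
    exact/measurable_EFinP/measurable_funM.
  move=> x _ /=; rewrite lee_fin !normrM normr_id ler_pM//.
  by rewrite (le_trans (WK x))// ler_norm.
have key N : (`|\int[P]_x (Z x * Y x)%:E| <= (N.+1%:R^-1)%:E * \int[P]_x `|Y x|%:E)%E.
  set n := (N.+1%:R : R); have n0 : 0 < n by rewrite ltr0n.
  (* With this [K], n Z stays below K + 1, so K + 1 steps cover the range of [Z]. *)
  pose K := Num.Def.truncn (n * M); pose A k := [set x | k.+1%:R / n <= Z x].
  pose ZN x := n^-1 * \sum_(k < K.+1) \1_(A k) x.
  have mA k : G (A k) by exact: sub_measurable_ge.
  have mZN : measurable_fun setT ZN.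
    apply: measurable_funM => //; apply: measurable_sum => k.
    by apply: measurable_indic; exact/GF/mA.
  have Z_ZN x : `|Z x - ZN x| <= n^-1.
    have -> : Z x - ZN x = n^-1 * (n * Z x - \sum_(k < K.+1) (k.+1%:R <= n * Z x)%R%:R).
      rewrite mulrBr mulKf ?gt_eqF//; congr (_ - _ * _).
      apply: eq_bigr => k _; rewrite indicE/=; congr (nat_of_bool _)%:R.
      by apply/idP/idP => [/set_mem|H]; last apply/mem_set; rewrite /A/= ler_pdivrMr// mulrC.
    rewrite normrM gtr0_norm ?invr_gt0//; apply: ler_piMr; first by rewrite invr_ge0 ltW.
    have /andP[Z0 ZM] := Z0M x.
    apply: count_le_approx; first by rewrite mulr_ge0// ltW.
    rewrite ltW// (@le_lt_trans _ _ (n * M))//; first by rewrite ler_pM2l.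
    by rewrite truncnS_gt.
  have ZN0 : (\int[P]_x (ZN x * Y x)%:E = 0)%E.
    under eq_integral do rewrite -mulrA EFinM.
    have iA k : P.-integrable setT (EFin \o (fun x => \1_(A k) x * Y x)).
      apply: (iM _ 1); first exact/measurable_indic/GF/mA.
      by move=> x; rewrite indicE; case: (_ \in _); rewrite ?normr1 ?normr0.
    under eq_integral do rewrite mulr_suml -sumEFin.
    rewrite integralZl//; last first.
      exact: (@integrable_sum _ _ _ _ _ measurableT _ _ _
        (fun k : 'I_K.+1 => EFin \o (fun x => \1_(A k) x * Y x))).
    rewrite (@integral_sum _ _ _ _ _ measurableT _
        (fun k : 'I_K.+1 => EFin \o (fun x => \1_(A k) x * Y x)))//.
    rewrite big1 ?mule0// => k _.
    rewrite -[RHS](Y0 _ (mA k)) [RHS]integral_mkcond; apply: eq_integral => x _.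
    by rewrite /= patchE indicE; case: ifPn; rewrite ?mul1r ?mul0r.
  have -> : (\int[P]_x (Z x * Y x)%:E = \int[P]_x ((Z x - ZN x) * Y x)%:E)%E.
    under [RHS]eq_integral do rewrite mulrBl EFinB.
    rewrite integralB_EFin//.
    - by rewrite ZN0 sube0.
    - by apply: (iM _ M) => // x; have /andP[? ?] := Z0M x; rewrite ger0_norm.
    - apply: (iM _ (n^-1 + M)) => // x.
      rewrite -[ZN x](subrK (Z x)) (le_trans (ler_normD _ _))// lerD// 1?distrC//.
      by have /andP[? ?] := Z0M x; rewrite ger0_norm.
  pose D x := (Z x - ZN x) * Y x.
  have mD : measurable_fun setT D by apply: measurable_funM => //; exact: measurable_funB.
  rewrite (le_trans (le_abse_integral _ _ _))//.
    exact/measurable_EFinP.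
  rewrite -ge0_integralZl//; last 2 first.
  - by apply/measurable_EFinP; exact: measurableT_comp.
  - by rewrite lee_fin invr_ge0 ltW.
  - apply: ge0_le_integral => //.
    + rewrite [X in measurable_fun _ X](_ : _ = EFin \o (Num.norm \o D))//.
      by apply/measurable_EFinP; exact: measurableT_comp.
    + apply: measurable_funeM.
      rewrite [X in measurable_fun _ X](_ : _ = EFin \o (Num.norm \o Y))//.
      by apply/measurable_EFinP; exact: measurableT_comp.
    + by move=> x _ /=; rewrite lee_fin normrM ler_wpM2r.
have fY : (\int[P]_x `|Y x|%:E)%E \is a fin_num.
  by have /integrable_norm/integrable_fin_num := iY; apply.
apply/eqP; rewrite -abse_eq0 eq_le abse_ge0 andbT.
apply/lee_addgt0Pr => e e0; rewrite add0e.
pose c := fine (\int[P]_x `|Y x|%:E)%E.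
have c0 : 0 <= c by rewrite fine_ge0// integral_ge0.
apply: (le_trans (key (Num.Def.truncn (c / e)))).
rewrite -(fineK fY) -EFinM lee_fin -/c mulrC ler_pdivrMr ?ltr0n//.
by rewrite mulrC -ler_pdivrMr// ltW// truncnS_gt.
Qed.

Lemma pull_out Y Z (M : R) : P.-integrable setT (EFin \o Y) ->
  (forall A, G A -> \int[P]_(x in A) (Y x)%:E = 0)%E ->
  measurable_wrt G Z -> (forall x, `|Z x| <= M) ->
  (\int[P]_x (Z x * Y x)%:E = 0)%E.
Proof.
move=> iY Y0 mZ ZM.
have H1 : (\int[P]_x ((Z x + M) * Y x)%:E = 0)%E.
  apply: (@pull_out_pos _ _ (M + M)) => //.
    by apply: measurable_funD => //.
  by move=> x; have := ZM x; rewrite ler_norml => /andP[]; lra.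
have GT : G setT by case: sG => G0 /(_ _ G0); rewrite setD0.
have H2 : (\int[P]_x (M * Y x)%:E = 0)%E.
  by under eq_integral do rewrite EFinM; rewrite integralZl// Y0// mule0.
have mY : measurable_fun setT Y by apply/measurable_EFinP; exact: measurable_int iY.
have iM W K : measurable_fun setT W -> (forall x, `|W x| <= K) ->
    P.-integrable setT (EFin \o (fun x => W x * Y x)).
  move=> mW WK; apply: le_integrable (integrableZl _ (`|K|) iY) => //.
    exact/measurable_EFinP/measurable_funM.
  move=> x _ /=; rewrite lee_fin !normrM normr_id ler_pM//.
  by rewrite (le_trans (WK x))// ler_norm.
have mZ' := measurable_wrtW sG GF mZ.
transitivity (\int[P]_x ((Z x + M) * Y x)%:E - \int[P]_x (M * Y x)%:E)%E; last first.
  by rewrite H1 H2 sube0.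
rewrite -integralB_EFin//.
- by apply: eq_integral => x _; rewrite -EFinB; congr EFin; ring.
- apply: (iM _ (M + `|M|)); first exact: measurable_funD.
  by move=> x; rewrite (le_trans (ler_normD _ _))// lerD2r.
- exact: (iM _ `|M|).
Qed.

End pull_out.

(** * Filtrations and closure of martingales bounded in L^2 *)

Lemma filtration_sigma d (T : measurableType d) (F : nat -> set (set T)) n :
  filtration F -> sigma_algebra setT (F n).
Proof. by case. Qed.

Lemma filtration_sub d (T : measurableType d) (F : nat -> set (set T)) n :
  filtration F -> F n `<=` measurable.
Proof. by case. Qed.

Lemma filtration_le d (T : measurableType d) (F : nat -> set (set T)) m n :
  filtration F -> (m <= n)%N -> F m `<=` F n.
Proof. by case=> _ _ h _; exact: h. Qed.

Lemma measurable_wrt_le d (T : measurableType d) (R : realType)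
    (F : nat -> set (set T)) m n (Y : T -> R) :
  filtration F -> (m <= n)%N -> measurable_wrt (F m) Y -> measurable_wrt (F n) Y.
Proof.
move=> hF mn mY _ B mB; have := mY measurableT B mB.
by rewrite !(measurable_g_sigmaE (filtration_sigma _ hF)); exact: (filtration_le hF mn).
Qed.

Section closed_martingale.
Context d (T : measurableType d) (R : realType) (P : probability T R).
Variables (F : nat -> set (set T)) (e : nat -> T -> R) (M : R).
Hypothesis hF : filtration F.
Hypothesis me : forall i, measurable_wrt (F i.+1) (e i).
Hypothesis be : forall i x, `|e i x| <= M.
Hypothesis e0 : forall i A, F i A -> (\int[P]_(x in A) (e i x)%:E = 0)%E.
Let h n x := \sum_(i < n) e i x.

Let sF n := filtration_sigma n hF.
Let Fm n := @filtration_sub _ _ F n hF.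

Let be_bm i : bounded_meas (e i).
Proof. by split; [exact: (measurable_wrtW (sF i.+1) (@Fm i.+1) (@me i)) | exists M]. Qed.

Let h_bm n : bounded_meas (h n). Proof. exact: bounded_meas_sum. Qed.

Let h_wrt n : measurable_wrt (F n) (h n).
Proof.
apply: measurable_sum => i.
by apply: measurable_wrt_le (@me i) => //; exact: ltn_ord.
Qed.

Let bmB (W W' : T -> R) : bounded_meas W -> bounded_meas W' ->
  bounded_meas (fun x => W x - W' x).
Proof.
move=> bW bW'; under eq_fun do rewrite -mulN1r.
by apply: bounded_measD => //; apply: bounded_measM => //; exact: bounded_meas_cst.
Qed.

Let hS n x : h n.+1 x = h n x + e n x. Proof. by rewrite /h big_ord_recr. Qed.

Let bm2 (W : T -> R) : bounded_meas W -> bounded_meas (fun x => W x ^+ 2).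
Proof. by move=> bW; under eq_fun do rewrite expr2; exact: bounded_measM. Qed.

(** Pythagoras: the cross term vanishes by [pull_out], since [h (n + k) - h n] is bounded and
    measurable for [F (n + k)], while [e (n + k)] integrates to 0 over the sets of [F (n + k)]. *)
Lemma orthogonal_increments n k :
  \int[P]_x ((h (n + k)%N x - h n x) ^+ 2) = \sum_(i < k) \int[P]_x (e (n + i)%N x ^+ 2).
Proof.
elim: k => [|k IH].
  rewrite big_ord0 addn0 /Rintegral; under eq_integral do rewrite subrr expr0n.
  by rewrite integral0.
rewrite big_ord_recr/= -IH.
have cross : \int[P]_x (2 * (h (n + k)%N x - h n x) * e (n + k)%N x) = 0.
  have [K hK] := (bmB (h_bm (n + k)) (h_bm n)).2.
  rewrite /Rintegral (@pull_out _ _ _ P (F (n + k)%N) (sF _) (@Fm _) _ _ (2 * K))//.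
  - exact/bounded_meas_integrable.
  - by move=> A; exact: e0.
  - apply: measurable_funM => //; apply: measurable_funB; first exact: h_wrt.
    exact: (measurable_wrt_le hF (leq_addr k n) (@h_wrt n)).
  - by move=> x; rewrite normrM ger0_norm// ler_pM2l.
have iI W : bounded_meas W -> P.-integrable setT (EFin \o W).
  exact: bounded_meas_integrable.
have b1 := bmB (h_bm (n + k)) (h_bm n).
transitivity (\int[P]_x ((h (n + k)%N x - h n x) ^+ 2 +
   (2 * (h (n + k)%N x - h n x) * e (n + k)%N x + e (n + k)%N x ^+ 2))).
  by apply: eq_Rintegral => x _; rewrite addnS hS; ring.
have b2 : bounded_meas (fun x => 2 * (h (n + k)%N x - h n x) * e (n + k)%N x).
  by apply: bounded_measM => //; apply: bounded_measM => //; exact: bounded_meas_cst.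
rewrite RintegralD//; first last.
- by apply: iI; apply: bounded_measD => //; exact: bm2.
- by apply: iI; exact: bm2.
rewrite RintegralD//; first last.
- by apply: iI; exact: bm2.
- by apply: iI.
by rewrite cross add0r.
Qed.

Let int_h n m A : (n <= m)%N -> F n A ->
  (\int[P]_(x in A) (h m x)%:E = \int[P]_(x in A) (h n x)%:E)%E.
Proof.
move=> + FA; have mA := Fm FA; elim: m => [|m IH]; first by rewrite leqn0 => /eqP ->.
rewrite leq_eqVlt => /predU1P[->//|]; rewrite ltnS => nm.
under eq_integral do rewrite hS EFinD.
rewrite integralD//; try by apply: integrableS (bounded_meas_integrable _ _).
rewrite e0 ?adde0 ?IH//; exact: (filtration_le hF nm).
Qed.

Hypothesis L2 : exists C, forall n, \sum_(i < n) \int[P]_x (e i x ^+ 2) <= C.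

(* The partial sums [h n] are Cauchy in L^2; a rapidly converging subsequence converges almost
   surely and is dominated by an integrable function. *)
Lemma closed_martingale : exists A : T -> R, P.-integrable setT (EFin \o A) /\
  forall n, is_cexp P (F n) A (h n).
Proof.
have [C HC] := L2.
pose H n := \sum_(i < n) \int[P]_x (e i x ^+ 2).
have c0 i : 0 <= \int[P]_x (e i x ^+ 2) by apply: Rintegral_ge0 => x _; rewrite sqr_ge0.
have Hnd : {homo H : m n / (m <= n)%N >-> m <= n}.
  by apply/nondecreasing_seqP => n; rewrite /H big_ord_recr/= lerDl.
have Hinc n k : \int[P]_x ((h (n + k)%N x - h n x) ^+ 2) = H (n + k)%N - H n.
  by rewrite orthogonal_increments /H big_split_ord/= [RHS]addrC addKr.
have hsup : has_sup (range H).
  by split; [exists (H 0%N), 0%N | exists C => _ [n _ <-]; exact: HC].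
have tail (k : nat) : exists n, forall m, (n <= m)%N -> H m - H n <= (2^-1) ^+ k * (2^-1) ^+ k.
  have pk : 0 < (2^-1) ^+ k * (2^-1) ^+ k :> R by rewrite mulr_gt0// exprn_gt0.
  have [_ [n _ <-] Hn] := sup_adherent pk hsup.
  exists n => m nm; rewrite lerBlDl -lerBlDr (le_trans _ (ltW Hn))// lerB//.
  by apply: ub_le_sup; [case: hsup | exists m].
have [N0 N0P] := choice tail.
(* The successor makes [N] strictly increasing, hence k <= [N k]; the maximum with [N0 k] keeps the
   tail of [H] beyond [N k] below 4^-k. *)
pose N := fix N k := if k is k'.+1 then maxn (N k').+1 (N0 k) else N0 0%N.
have NN0 k : (N0 k <= N k)%N by case: k => //= k; rewrite leq_maxr.
have Nlt k : (N k < N k.+1)%N by rewrite /= leq_maxl.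
have kN k : (k <= N k)%N by elim: k => // k IH; exact: leq_ltn_trans (Nlt k).
pose u k := h (N k).
have ubm k : bounded_meas (u k) by exact: h_bm.
have dif k : (\int[P]_x `|u k.+1 x - u k x|%:E <= ((2^-1) ^+ k)%:E)%E.
  set r := (2^-1) ^+ k : R; have r0 : 0 < r by rewrite exprn_gt0.
  have bd := bmB (ubm k.+1) (ubm k).
  have sq : \int[P]_x ((u k.+1 x - u k x) ^+ 2) <= r * r.
    have NN := ltnW (Nlt k).
    rewrite /u -{1}(subnKC NN) Hinc subnKC//.
    apply: le_trans (N0P k _ (leq_trans (NN0 k) NN)).
    by rewrite lerB// Hnd.
  (* From L^2 to L^1 by |w| <= r/2 + w^2/(2r), that is (r - |w|)^2 >= 0; with int w^2 <= r^2 the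
     right side integrates to at most r. *)
  apply: (@le_trans _ _ (\int[P]_x (2^-1 * r + (2^-1 * r^-1) * (u k.+1 x - u k x) ^+ 2)%:E)%E).
    apply: ge0_le_integral => //.
    - by apply/measurable_EFinP; apply: measurableT_comp => //; exact: bd.1.
    - by apply/measurable_EFinP/measurable_funD => //; apply: measurable_funM => //; exact: (bm2 bd).1.
    - move=> x _; rewrite lee_fin; set w := u k.+1 x - u k x.
      have : 0 <= r^-1 * (r - `|w|) ^+ 2 by rewrite mulr_ge0 ?sqr_ge0// invr_ge0 ltW.
      rewrite sqrrB mulrDr mulrBr expr2 mulKf ?gt_eqF// real_normK ?num_real//.
      by rewrite -[_ *+ 2]mulr_natl [2 * _]mulrCA mulKf ?gt_eqF//; lra.
  have i1 : P.-integrable setT (EFin \o (fun x => (2^-1 * r^-1) * (u k.+1 x - u k x) ^+ 2)).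
    by apply: bounded_meas_integrable; exact: (bounded_measM (bounded_meas_cst T (2^-1 * r^-1)) (bm2 bd)).
  under eq_integral do rewrite EFinD.
  rewrite integralD//; last exact/bounded_meas_integrable/bounded_meas_cst.
  rewrite integral_cst// [X in (_ * X)%E]probability_setT mule1.
  under eq_integral do rewrite EFinM.
  have i2 : P.-integrable setT (EFin \o (fun x => (u k.+1 x - u k x) ^+ 2)).
    by apply: bounded_meas_integrable; exact: bm2.
  rewrite integralZl// -[X in (_ * X)%E]fineK ?integrable_fin_num//.
  rewrite -EFinM -EFinD lee_fin -[X in _ <= X](_ : 2^-1 * r + 2^-1 * r^-1 * (r * r) = r).
    by rewrite lerD2l ler_pM2l// mulr_gt0// invr_gt0.
  by rewrite -mulrA mulKf ?gt_eqF//; lra.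
pose g x := (`|u 0%N x|%:E + \sum_(k <oo) `|u k.+1 x - u k x|%:E)%E.
have g0 x : (0 <= g x)%E by rewrite adde_ge0// nneseries_ge0.
have mdif k : measurable_fun setT (fun x => `|u k.+1 x - u k x|%:E)%E.
  by apply/measurable_EFinP; apply: measurableT_comp => //; exact: (bmB (ubm k.+1) (ubm k)).1.
have mu0 : measurable_fun setT (fun x => `|u 0%N x|%:E)%E.
  by apply/measurable_EFinP; apply: measurableT_comp => //; exact: (ubm _).1.
have mg : measurable_fun setT g.
  by apply: emeasurable_funD => //; apply: ge0_emeasurable_sum.
have ig : P.-integrable setT g.
  apply/integrableP; split=> //.
  under eq_integral do rewrite gee0_abs//.
  rewrite ge0_integralD//; last 2 first.
    by move=> x _; rewrite nneseries_ge0.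
    exact: ge0_emeasurable_sum.
  rewrite lte_add_pinfty//.
    have /integrableP[_] := bounded_meas_integrable P (ubm 0%N).
    by under eq_integral do rewrite /=.
  rewrite integral_nneseries//.
  apply: (@le_lt_trans _ _ (\sum_(k <oo) ((2^-1) ^+ k)%:E)%E).
    by apply: lee_nneseries => // k _; rewrite integral_ge0.
  have := @cvg_geometric_series R 1 2^-1.
  rewrite ger0_norm// => /(_ ltac:(lra)) /cvgP.
  move=> cv; rewrite (_ : (fun _ => _) = EFin \o series (geometric 1 2^-1)); last first.
    apply/funext => n /=; rewrite sumEFin; congr EFin; apply: eq_bigr => k _.
    by rewrite /geometric/= mul1r.
  by rewrite EFin_lim// ltry.
have ug k x : (`|(u k x)%:E| <= g x)%E.
  apply: (@le_trans _ _ (`|u 0%N x|%:E + \sum_(0 <= j < k) `|u j.+1 x - u j x|%:E)%E).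
    elim: k => [|k IH]; first by rewrite big_geq// adde0.
    rewrite big_nat_recr//= addeA (le_trans _ (leeD2r _ IH))//.
    by rewrite lee_fin -{1}[u k.+1 x](subrK (u k x)) addrC ler_normD.
  by rewrite leeD2l// nneseries_lim_ge.
have ucv x : (g x < +oo)%E -> cvgn (u ^~ x).
  move=> gx.
  have gfin : g x \is a fin_num by rewrite ge0_fin_numE.
  rewrite (_ : u^~ x = cst (u 0%N x) + series (telescope (u^~ x))); last first.
    by apply/funext => n; rewrite [LHS](eq_sum_telescope (u^~ x)).
  apply: is_cvgD; first exact: is_cvg_cst.
  apply: normed_cvg; apply: nondecreasing_is_cvgn.
    by apply/nondecreasing_seqP => n; rewrite -subr_ge0 /normed_series_of seriesSB; exact: normr_ge0.
  exists (fine (g x)) => _ [n _ <-]; rewrite -lee_fin fineK// /g -sumEFin.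
  apply: (@le_trans _ _ (\sum_(0 <= k < n) `|u k.+1 x - u k x|%:E)%E) => //.
  by apply: (le_trans (nneseries_lim_ge n _)) => //; rewrite leeDr.
(* The upper limit is measurable without any convergence assumption; it is the limit of [u k x]
   wherever [g x] is finite, hence almost surely. *)
pose A x := fine (limn_esup (fun k => (u k x)%:E)).
have mA : measurable_fun setT A.
  apply: (@measurableT_comp _ _ _ _ _ _ fine _ (fun x => limn_esup (fun k => (u k x)%:E))).
    exact: fine_measurable.
  by apply: measurable_fun_limn_esup => k; apply/measurable_EFinP; exact: (ubm k).1.
have uA : {ae P, forall x, (fun k => (u k x)%:E) @ \oo --> (A x)%:E}.
  apply: filterS (integrable_ae measurableT ig) => x /(_ I) gx.
  have cu : cvgn (u^~ x) by apply: ucv; rewrite -ge0_fin_numE.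
  have cE : (fun k => (u k x)%:E) @ \oo --> (limn (u^~ x))%:E.
    by apply: cvg_EFin; [exact: nearW | exact: cu].
  by rewrite /A is_cvg_limn_esupE ?(cvg_lim _ cE)//; apply/cvg_ex; exists (limn (u^~ x))%:E.
have dct D : measurable D -> P.-integrable D (EFin \o A) /\
    (fun k => \int[P]_(x in D) (u k x)%:E)%E @ \oo --> (\int[P]_(x in D) (A x)%:E)%E.
  move=> mD.
  have [] := @dominated_convergence _ T R P D mD (fun k => EFin \o u k) (EFin \o A) g => //.
  - by move=> k; apply/measurable_EFinP/measurable_funTS; exact: (ubm k).1.
  - by apply/measurable_EFinP/measurable_funTS.
  - by apply: filterS uA => x.
  - exact: (integrableS measurableT).
  - by apply: aeW => x n _; exact: ug.
exists A; split; first by case: (dct setT measurableT).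
move=> n; split; first exact: h_wrt.
  exact: bounded_meas_integrable.
move=> B FB; have [_ cB] := dct B (Fm FB).
rewrite -(cvg_lim _ cB)//; apply/esym/cvg_lim => //.
(* For B in [F n], the martingale property makes the integrals over B constant as soon as [N k] >=
   n. *)
apply: (@cvg_trans _ ((fun _ : nat => (\int[P]_(x in B) (h n x)%:E)%E) @ \oo)); last exact: cvg_cst.
apply: near_eq_cvg; near=> k; rewrite (@int_h n)//.
by rewrite (leq_trans _ (kN k))//; near: k; exact: nbhs_infty_ge.
Unshelve. all: by end_near. Qed.

End closed_martingale.
Section closed_martingale_ae.
Context d (T : measurableType d) (R : realType) (P : probability T R).

Lemma integrable_aeq (X Y : T -> R) : measurable_fun setT Y ->
  {ae P, forall x, X x = Y x} -> P.-integrable setT (EFin \o X) ->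
  P.-integrable setT (EFin \o Y).
Proof.
move=> mY XY /integrableP[mX iX]; apply/integrableP; split.
  exact/measurable_EFinP.
rewrite -(@ge0_ae_eq_integral _ _ _ P setT (abse \o (EFin \o X)))//.
- exact: measurableT_comp.
- by apply: measurableT_comp => //; exact/measurable_EFinP.
- by move=> x _; rewrite /= lee_fin.
- by apply: filterS XY => x /= ->.
Qed.

Lemma is_cexp_aeq_r (G : set (set T)) (X Y Y' : T -> R) :
  G `<=` measurable -> measurable_wrt G Y' -> measurable_fun setT Y' ->
  {ae P, forall x, Y x = Y' x} -> is_cexp P G X Y -> is_cexp P G X Y'.
Proof.
move=> GF mY' mY'' YY' [mY iY YX]; split => //; first exact: integrable_aeq YY' iY.
move=> A GA; rewrite -YX//; apply: ae_eq_integral => //.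
- exact: GF.
- exact/measurable_EFinP/measurable_funTS.
- by apply: measurable_funTS; exact: measurable_int iY.
- by apply: filterS YY' => x /= ->.
Qed.

Lemma Rintegral_le_ae (W : T -> R) (C : R) : bounded_meas W -> (forall x, 0 <= W x) ->
  0 <= C -> {ae P, forall x, W x <= C} -> \int[P]_x W x <= C.
Proof.
move=> bW W0 C0 WC; have iW := bounded_meas_integrable P bW.
rewrite -lee_fin /Rintegral fineK ?integrable_fin_num//.
apply: (@le_trans _ _ (\int[P]_x (cst C%:E) x)%E).
  apply: ae_ge0_le_integral => //.
  - by move=> x _; rewrite lee_fin.
  - exact: measurable_int iW.
  - by apply: filterS WC => x /= Wx _; rewrite lee_fin.
by rewrite integral_cst// [X in (_ * X)%E]probability_setT mule1.
Qed.

Variables (F : nat -> set (set T)) (e : nat -> T -> R) (M : R).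
Hypothesis hF : filtration F.
Hypothesis me : forall i, measurable_wrt (F i.+1) (e i).
Hypothesis be : forall i, {ae P, forall x, `|e i x| <= M}.
Hypothesis e0 : forall i A, F i A -> (\int[P]_(x in A) (e i x)%:E = 0)%E.
Hypothesis M0 : 0 <= M.

(** Almost sure bounds are made pointwise by clipping the increments at M. Either alternative bounds
    the sum of the int e_i^2 by M^2: under the first it is the integral of the sum of squares, under
    the second it equals the integral of the squared partial sum by orthogonality. *)
Lemma closed_martingale_ae :
  (forall n, {ae P, forall x, \sum_(i < n) e i x ^+ 2 <= M ^+ 2}) \/
  (forall n, {ae P, forall x, `|\sum_(i < n) e i x| <= M}) ->
  exists A : T -> R, P.-integrable setT (EFin \o A) /\
    forall n, is_cexp P (F n) A (fun x => \sum_(i < n) e i x).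
Proof.
move=> bnd.
have sF n := filtration_sigma n hF.
have Fm n := @filtration_sub _ _ F n hF.
pose e' i x := Num.max (- M) (Num.min (e i x) M).
have me' i : measurable_wrt (F i.+1) (e' i).
  by apply: measurable_maxr => //; apply: measurable_minr => //; exact: me.
have be' i x : `|e' i x| <= M.
  rewrite ler_norml /e' le_max lexx/= ge_max ge_min lexx orbT andbT.
  by rewrite lerNl (le_trans _ M0)// oppr_le0.
have ee' : {ae P, forall x, forall i, e i x = e' i x}.
  apply/ae_foralln => i; apply: filterS (be i) => x.
  by rewrite ler_norml => /andP[h1 h2]; rewrite /e' min_l// max_r.
have mei i : measurable_fun setT (e i) := measurable_wrtW (sF i.+1) (@Fm i.+1) (@me i).
have mei' i : measurable_fun setT (e' i) := measurable_wrtW (sF i.+1) (@Fm i.+1) (@me' i).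
have be'_bm i : bounded_meas (e' i) by split => //; exists M; exact: be'.
have e0' i A : F i A -> (\int[P]_(x in A) (e' i x)%:E = 0)%E.
  move=> FA; rewrite -(e0 FA); apply: ae_eq_integral => //.
  - exact: (@Fm i).
  - exact/measurable_EFinP/measurable_funTS.
  - exact/measurable_EFinP/measurable_funTS.
  - by apply: filterS ee' => x /= ->.
have [A [iA HA]] : exists A : T -> R, P.-integrable setT (EFin \o A) /\
    forall n, is_cexp P (F n) A (fun x => \sum_(i < n) e' i x).
  apply: (closed_martingale hF me' be' e0'); exists (M ^+ 2) => n.
  have b2 W : bounded_meas W -> bounded_meas (fun x : T => W x ^+ 2 : R).
    by move=> bW; under eq_fun do rewrite expr2; exact: bounded_measM.
  case: bnd => H.
    have -> : \sum_(i < n) \int[P]_x (e' i x ^+ 2) = \int[P]_x \sum_(i < n) e' i x ^+ 2.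
      elim: n => [|n IH].
        by rewrite big_ord0 /Rintegral; under eq_integral do rewrite big_ord0; rewrite integral0.
      rewrite big_ord_recr/= IH -RintegralD//.
      - by apply: eq_Rintegral => x _; rewrite big_ord_recr.
      - apply: bounded_meas_integrable; apply: (bounded_meas_sum n (w := fun i x => e' i x ^+ 2)).
        by move=> i; exact: b2.
      - by apply: bounded_meas_integrable; exact: b2.
    apply: Rintegral_le_ae.
    - by apply: (bounded_meas_sum n (w := fun i x => e' i x ^+ 2)) => i; exact: b2.
    - by move=> x; apply: sumr_ge0 => i _; rewrite sqr_ge0.
    - by rewrite sqr_ge0.
    - by apply: filterS2 ee' (H n) => x Ex; under eq_bigr do rewrite Ex.
  have := @orthogonal_increments _ _ _ P _ _ _ hF me' be' e0' 0 n.
  rewrite add0n => <-.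
  apply: Rintegral_le_ae.
  - rewrite [X in bounded_meas X](_ : _ = fun x => (\sum_(i < n) e' i x) ^+ 2).
      exact: (b2 _ (bounded_meas_sum n be'_bm)).
    by apply/funext => x; rewrite big_ord0 subr0.
  - by move=> x; rewrite sqr_ge0.
  - by rewrite sqr_ge0.
  - apply: filterS2 ee' (H n) => x Ex; rewrite big_ord0 subr0.
    under eq_bigr do rewrite Ex.
    by move=> h; rewrite -[leLHS]real_normK ?num_real// lerXn2r ?nnegrE.
exists A; split=> // n; apply: is_cexp_aeq_r (HA n) => //.
- apply: measurable_sum => i.
  exact: (measurable_wrt_le hF (ltn_ord i) (@me i)).
- exact: measurable_sum.
- by apply: filterS ee' => x Ex; apply: eq_bigr.
Qed.

End closed_martingale_ae.

(** * Unordered sums of extended reals *)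

Section esum_lemmas.
Context (R : realType).
Local Open Scope ereal_scope.

Lemma esumZl (I : choiceType) (D : set I) (a : I -> \bar R) (r : R) :
  (0 <= r)%R -> (forall i, 0 <= a i) ->
  \esum_(i in D) (r%:E * a i) = r%:E * \esum_(i in D) a i.
Proof.
move=> r0 a0; rewrite /esum -ereal_supZl//; last first.
  by apply/set0P; exists (\sum_(i \in set0) a i), set0 => //; exact: fsets_set0.
congr ereal_sup; rewrite image_comp/=; apply: eq_imagel => A _ /=.
by rewrite ge0_mule_fsumr.
Qed.

Lemma le_esum_term (I : choiceType) (a : I -> \bar R) k :
  (forall i, 0 <= a i) -> a k <= \esum_(i in [set: I]) a i.
Proof.
move=> a0; apply: esum_ge; exists [set k]; last by rewrite fsbig_set1.
by split => //; exact: finite_set1.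
Qed.

(** Dominated convergence for the counting measure: a finite set of indices carries all but eps/2 of
    the sum of [v], and on that set there are only finitely many terms to make small. *)
Lemma esum_dominated_cvg0 (I : choiceType) (u : nat -> I -> \bar R) (v : I -> \bar R) :
  (forall n i, 0 <= u n i <= v i) -> \esum_(i in [set: I]) v i < +oo ->
  (forall i, u ^~ i @ \oo --> 0) ->
  forall eps : R, (0 < eps)%R ->
  \forall n \near \oo, \esum_(i in [set: I]) u n i <= eps%:E.
Proof.
move=> uv vfin u0 eps e0.
have v0 i : 0 <= v i by case/andP: (uv 0%N i) => /le_trans; exact.
have S0 : 0 <= \esum_(i in [set: I]) v i by exact: esum_ge0.
have Sf : \esum_(i in [set: I]) v i \is a fin_num by rewrite ge0_fin_numE.
have e20 : (0 < eps / 2)%R by rewrite divr_gt0.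
have [_ [X [finX _] <-] HX] := @ub_ereal_sup_adherent _ _ _ e20 Sf.
have tail : \esum_(i in ~` X) v i <= (eps / 2)%:E.
  move: HX Sf; rewrite -/(esum setT v) (esumID X setT)// !setTI.
  rewrite -(@esum_fset _ _ X)//.
  have : 0 <= \esum_(i in X) v i by exact: esum_ge0.
  have : 0 <= \esum_(i in ~` X) v i by exact: esum_ge0.
  case: (\esum_(i in X) v i) => [x| |]//; case: (\esum_(i in ~` X) v i) => [y| |]//.
  by rewrite -EFinD -EFinB lte_fin lee_fin => *; rewrite lee_fin; lra.
have head : (fun n => \sum_(i <- finmap.enum_fset (fset_set X)) u n i) @ \oo --> 0.
  have z : 0 = \sum_(i <- finmap.enum_fset (fset_set X)) (fun=> 0 : \bar R) i by rewrite big1.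
  rewrite [X in _ --> X]z.
  apply: (@cvg_nnesum _ _ _ _ _ _ (fun i n => u n i) (fun=> 0)) => i _; last exact: u0.
  by apply: nearW => n; case/andP: (uv n i).
have N0 : nbhs (0 : \bar R) [set y | y < (eps / 2)%:E].
  apply: open_nbhs_nbhs; split; first exact: open_ereal_lt_ereal.
  by rewrite /= lte_fin.
have hd : \forall n \near \oo, \sum_(i <- finmap.enum_fset (fset_set X)) u n i < (eps / 2)%:E := head _ N0.
apply: filterS hd => n un.
rewrite (esumID X setT)/= ?setTI; last by move=> i _; case/andP: (uv n i).
have -> : (eps%:E = (eps / 2)%:E + (eps / 2)%:E) by rewrite -EFinD -splitr.
rewrite leeD//.
  rewrite esum_fset//; last by move=> i _; case/andP: (uv n i).
  by rewrite fsbig_finite//= ltW.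
by apply: le_trans tail; apply: le_esum => i _; case/andP: (uv n i).
Qed.

Lemma zsum_le_esum (a : int -> R) lm : (forall k, 0 <= a k)%R ->
  (zsum a lm)%:E <= \esum_(k in [set: int]) (a k)%:E.
Proof.
move=> a0; apply: esum_ge.
pose s := [seq i%:Z - lm.1%:Z | i <- iota 0 (lm.1 + lm.2).+1]%R.
exists [set` s]; first by split => //; exact: finite_seq.
rewrite -fsbig_seq; last first.
  by rewrite map_inj_uniq ?iota_uniq// => i j /addIr [].
by rewrite big_map /zsum -(big_mkord xpredT (fun i => a (i%:Z - lm.1%:Z)%R)) sumEFin /index_iota subn0.
Qed.

(** Enumerating the integers by [pickle] gives an ordinary series, which is how such sums of
    functions are shown to be measurable. *)
Lemma esum_int_nneseries (a : int -> \bar R) : (forall k, 0 <= a k) ->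
  \esum_(k in [set: int]) a k =
  \sum_(n <oo) (if n \in range (pickle : int -> nat) then oapp a 0 (unpickle n) else 0).
Proof.
move=> a0.
rewrite nneseries_esumT; last by move=> n; case: ifP => // _; case: (unpickle _).
rewrite -[RHS](esum_mkcond (range (pickle : int -> nat)) (fun n => oapp a 0 (unpickle n))).
rewrite esum_image; last by move=> i j _ _; exact: (pcan_inj pickleK).
by apply: eq_esum => k _; rewrite pickleK.
Qed.

Lemma emeasurable_esum_int d (T : measurableType d) (f : int -> T -> \bar R) :
  (forall k x, 0 <= f k x) -> (forall k, measurable_fun setT (f k)) ->
  measurable_fun setT (fun x => \esum_(k in [set: int]) f k x).
Proof.
move=> f0 mf; under eq_fun do rewrite esum_int_nneseries//.
apply: ge0_emeasurable_sum => [n x _ _|n _].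
  by case: ifP => // _; case: (unpickle _) => [k|]//=.
by case: (n \in range (pickle : int -> nat)); [case: (unpickle _) => [k|]/=; [exact: mf | exact: measurable_cst]
  | exact: measurable_cst].
Qed.

(* With [s] the right-hand sum, each [a k = (a k `^ eta) `^ eta^-1] is at most
   [a k `^ eta * s `^ (eta^-1 - 1)]. *)
Lemma esum_le_poweR (eta : R) (a : int -> R) : (0 < eta <= 1)%R ->
  (forall k, 0 <= a k)%R ->
  \esum_(k in [set: int]) (a k)%:E <= (\esum_(k in [set: int]) (a k `^ eta)%:E) `^ eta^-1.
Proof.
move=> /andP[eta0 eta1] a0.
have pa0 k : 0 <= (a k `^ eta)%:E by rewrite lee_fin powR_ge0.
have := @le_esum_term _ (fun k => (a k `^ eta)%:E) _ pa0.
have : 0 <= \esum_(k in [set: int]) (a k `^ eta)%:E by exact: esum_ge0.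
case E : (\esum_(k in [set: int]) (a k `^ eta)%:E) => [s| |]// s0 ks; last first.
  by rewrite poweRyr ?leey// invr_neq0// gt_eqF.
rewrite lee_fin in s0.
have i1 : (1 <= eta^-1)%R by rewrite invf_ge1.
apply: (@le_trans _ _ (\esum_(k in [set: int]) ((s `^ (eta^-1 - 1))%:E * (a k `^ eta)%:E))).
  apply: le_esum => k _; rewrite -EFinM lee_fin.
  have [->|ak] := eqVneq (a k) 0%R; first by rewrite mulr_ge0 ?powR_ge0.
  have akE : (a k = (a k `^ eta) `^ (eta^-1 - 1) * (a k `^ eta))%R.
    rewrite -{2}[(a k `^ eta)%R]powRr1 ?powR_ge0// -powRD ?subrK; last first.
      by apply/implyP => _; rewrite powR_eq0 negb_and ak.
    by rewrite -powRrM mulfV ?gt_eqF// powRr1.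
  rewrite {1}akE ler_wpM2r ?powR_ge0// ge0_ler_powR ?nnegrE ?powR_ge0 ?subr_ge0//.
  by have := ks k; rewrite lee_fin.
rewrite esumZl ?powR_ge0// E -EFinM lee_fin.
have [->|s1] := eqVneq s 0%R; first by rewrite mulr0 powR_ge0.
rewrite -{2}[s]powRr1// -powRD ?subrK//.
by rewrite s1 implybT.
Qed.

(** Only exponents k <= K, the integer part of log_2 t, contribute. They form a geometric series of
    ratio 2^-eta whose largest term 2^(K eta) is at most t^eta. *)
Lemma dyadic_sum (eta : R) (t : \bar R) : (0 < eta)%R -> 0 <= t ->
  \esum_(k in [set: int])
    (if (2 `^ k%:~R)%:E < t then (2 `^ k%:~R `^ eta)%:E else 0)
  <= ((1 - 2 `^ (- eta))^-1)%:E * t `^ eta.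
Proof.
move=> eta0 t0; set z := (2 `^ (- eta))%R.
have z0 : (0 <= z)%R by rewrite powR_ge0.
have z1 : (z < 1)%R.
  rewrite /z powRN invf_lt1 ?powR_gt0//.
  by rewrite -ltr_ln ?posrE ?powR_gt0// ln1 ln_powR mulr_gt0// ln_gt0// ltr1n.
have c0 : (0 < (1 - z)^-1)%R by rewrite invr_gt0 subr_gt0.
case: t t0 => [t| |]// t0; last by rewrite poweRyr ?gt_eqF// gt0_muley ?lte_fin// leey.
rewrite lee_fin in t0; have [->|tn0] := eqVneq t 0%R.
  rewrite esum1; first by rewrite mule_ge0 ?poweR_ge0// lee_fin ltW.
  by move=> k _; rewrite lte_fin ltNge powR_ge0.
have tp : (0 < t)%R by rewrite lt_def tn0.
pose K := Num.floor (ln t / ln 2).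
have ln2 : (0 < ln 2 :> R)%R by rewrite ln_gt0// ltr1n.
have ltK k : (2 `^ k%:~R < t)%R -> (k <= K)%R.
  move=> kt; rewrite /K floor_ge_int ler_pdivlMr// -ln_powR.
  by rewrite ler_ln ?posrE ?powR_gt0// ltW.
have Kt : (2 `^ K%:~R <= t)%R.
  rewrite -ler_ln ?posrE ?powR_gt0// ln_powR -ler_pdivlMr//.
  by rewrite /K floor_le.
apply: (@le_trans _ _ (\esum_(k in [set k | k <= K]%R) (2 `^ k%:~R `^ eta)%:E)).
  rewrite [leRHS]esum_mkcond; apply: le_esum => k _.
  case: ifPn => [kt|_]; first by rewrite mem_set//=; apply: ltK; rewrite -lte_fin.
  by case: ifP => // _; rewrite lee_fin powR_ge0.
have -> : [set k | k <= K]%R = range (fun i : nat => K - i%:Z)%R.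
  apply/seteqP; split => [k /= kK|_ [i _ <-]/=]; last by rewrite gerBl.
  by exists `|K - k|%N => //; rewrite gez0_abs ?subr_ge0// subKr.
rewrite esum_image; last by move=> i j _ _ /addrI /oppr_inj [].
rewrite -nneseries_esumT; last by move=> n; rewrite lee_fin powR_ge0.
have -> : (fun n => \sum_(0 <= i < n) (2 `^ (K - i%:Z)%:~R `^ eta)%:E) =
    EFin \o series (geometric (2 `^ K%:~R `^ eta)%R z).
  apply/funext => n /=; rewrite sumEFin /series/=; congr EFin; apply: eq_bigr => i _.
  rewrite intrB powRD ?pnatr_eq0 ?implybT// powRM ?powR_ge0//; congr (_ * _)%R.
  by rewrite /z -powR_mulrn ?powR_ge0// -!powRrM; congr (_ `^ _)%R; rewrite !mulNr [in RHS]mulrC.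
have cg := @cvg_geometric_series R (2 `^ K%:~R `^ eta)%R z.
rewrite EFin_lim; last by apply: cvgP; apply: cg; rewrite ger0_norm.
rewrite (cvg_lim _ (cg _))// ?ger0_norm//.
rewrite poweR_EFin -EFinM lee_fin mulrC ler_pM2l//.
by apply: ge0_ler_powR => //; rewrite ?nnegrE ?powR_ge0// ltW.
Qed.

End esum_lemmas.

(** * Powers of extended reals, and convergence to 0 *)

Section ereal_power.
Context (R : realType).
Local Open Scope ereal_scope.

Lemma cvge0P (I : Type) (F : set_system I) (FF : Filter F) (u : I -> \bar R) :
  (forall i, 0 <= u i) ->
  (u @ F --> 0) <-> (forall e : R, (0 < e)%R -> \forall i \near F, u i <= e%:E).
Proof.
move=> u0; split => [cu e e0|H].
  have N0 : nbhs (0 : \bar R) [set y | y < e%:E].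
    apply: open_nbhs_nbhs; split; first exact: open_ereal_lt_ereal.
    by rewrite /= lte_fin.
  have hd : \forall i \near F, u i < e%:E := cu _ N0.
  by apply: filterS hd => i /ltW.
apply/fine_cvgP; split.
  apply: filterS (H 1%R ltr01) => i ui.
  by rewrite ge0_fin_numE//; apply: le_lt_trans ui _; exact: ltry.
apply/cvgrPdist_le => e e0; apply: filterS (H e e0) => i ui.
rewrite sub0r normrN /= ger0_norm ?fine_ge0//.
by rewrite -lee_fin fineK// ge0_fin_numE//; apply: le_lt_trans ui _; exact: ltry.
Qed.

Lemma le_poweR (r : R) (x y : \bar R) : (0 <= r)%R -> 0 <= x -> x <= y -> x `^ r <= y `^ r.
Proof.
move=> r0 x0 xy; apply: gt0_ler_poweR => //; rewrite in_itv/= leey andbT//.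
exact: le_trans xy.
Qed.

Lemma poweR_cvg0 (I : Type) (F : set_system I) (FF : Filter F) (u : I -> \bar R) (r : R) :
  (0 < r)%R -> (forall i, 0 <= u i) -> u @ F --> 0 -> (fun i => u i `^ r) @ F --> 0.
Proof.
move=> r0 u0 cu; apply/cvge0P => [i|e e0]; first exact: poweR_ge0.
have /(_ (e `^ r^-1)%R) := (@cvge0P _ _ FF _ u0).1 cu.
rewrite powR_gt0// => /(_ isT); apply: filterS => i ui.
apply: (le_trans (le_poweR (ltW r0) (u0 i) ui)).
by rewrite poweR_EFin -powRrM mulVf ?gt_eqF// powRr1// ltW.
Qed.

Lemma ereal_sup_poweR (X : set (\bar R)) (r : R) : (0 < r)%R -> (forall x, X x -> 0 <= x) ->
  X !=set0 -> ereal_sup [set x `^ r | x in X] = ereal_sup X `^ r.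
Proof.
move=> r0 X0 [x0 Xx0]; apply/eqP; rewrite eq_le; apply/andP; split.
  apply: ge_ereal_sup => _ [x Xx <-]; apply: le_poweR; [exact: ltW | exact: X0 |].
  exact: ereal_sup_ubound.
have S0 : 0 <= ereal_sup [set x `^ r | x in X].
  by apply: le_trans (poweR_ge0 x0 r) _; apply: ereal_sup_ubound; exists x0.
rewrite -[leRHS]poweRe1// -(mulVf (lt0r_neq0 r0)) poweRrM.
apply: le_poweR; [exact: ltW | | ].
  by apply: le_trans (X0 _ Xx0) _; exact: ereal_sup_ubound.
apply: ge_ereal_sup => x Xx.
rewrite -[leLHS]poweRe1 ?X0// -(mulfV (lt0r_neq0 r0)) poweRrM.
apply: le_poweR; [by rewrite invr_ge0 ltW | exact: poweR_ge0 |].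
by apply: ereal_sup_ubound; exists x.
Qed.

End ereal_power.

Lemma ae_forall_int d (T : measurableType d) (R : realType)
    (mu : {measure set T -> \bar R}) (Q : int -> T -> Prop) :
  (forall j, {ae mu, forall x, Q j x}) -> {ae mu, forall x, forall j, Q j x}.
Proof.
move=> H.
have : {ae mu, forall x, forall n : nat, if unpickle n is Some j then Q j x else True}.
  by apply/ae_foralln => n; case: (unpickle n) => [j|]; [exact: H | exact: aeW].
by apply: filterS => x Hx j; have := Hx (pickle j); rewrite pickleK.
Qed.

(** * Amalgam quasi-norms *)

Section amalgam.
Context d (T : measurableType d) (R : realType) (P : probability T R).
Variable Om : int -> set T.
Hypothesis mOm : forall j, measurable (Om j).
Hypothesis covOm : \bigcup_j Om j = setT.
Implicit Types (f g : T -> \bar R) (p : R) (q : \bar R).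
Local Open Scope ereal_scope.

Lemma measurable_abse_poweR f p (D : set T) : measurable_fun setT f ->
  measurable_fun D (fun x => `|f x| `^ p).
Proof.
move=> mf; apply: measurable_funTS.
apply: (@measurableT_comp _ _ _ _ _ _ (fun y : \bar R => y `^ p) _ (abse \o f)).
  exact: measurable_poweR.
exact: measurableT_comp.
Qed.

Lemma amalgam_norm_ge0 p q f : 0 <= amalgam_norm P Om p q f.
Proof.
case: q => [r| |]/=; first exact: poweR_ge0.
  by apply: le_trans (poweR_ge0 _ _) _; last by apply: ereal_sup_ubound; exists 0%R.
by apply: le_trans (poweR_ge0 _ _) _; last by apply: ereal_sup_ubound; exists 0%R.
Qed.

Lemma le_amalgam_norm p q f g : (0 < p)%R -> 0 < q ->
  measurable_fun setT f -> measurable_fun setT g -> (forall x, `|f x| <= `|g x|) ->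
  amalgam_norm P Om p q f <= amalgam_norm P Om p q g.
Proof.
move=> p0 q0 mf mg fg.
have le_int j : \int[P]_(x in Om j) (`|f x| `^ p) <= \int[P]_(x in Om j) (`|g x| `^ p).
  apply: ge0_le_integral => //.
  - by move=> x _; exact: poweR_ge0.
  - exact: measurable_abse_poweR.
  - exact: measurable_abse_poweR.
  - by move=> x _; apply: le_poweR => //; exact: ltW.
have i0 h j : 0 <= \int[P]_(x in Om j) (`|h x| `^ p).
  by apply: integral_ge0 => x _; exact: poweR_ge0.
case: q q0 => [r| |]//= r0.
  rewrite lte_fin in r0.
  apply: le_poweR; first by rewrite invr_ge0 ltW.
    by apply: esum_ge0 => j _; exact: poweR_ge0.
  apply: le_esum => j _; apply: le_poweR => //.
  by rewrite divr_ge0// ltW.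
apply: ge_ereal_sup => _ [j _ <-].
apply: (@le_trans _ _ ((\int[P]_(x in Om j) (`|g x| `^ p)) `^ p^-1)).
  by apply: le_poweR => //; rewrite invr_ge0 ltW.
by apply: ereal_sup_ubound; exists j.
Qed.

(** Rescaling of exponents: (c g^eta)^(p/eta) = c^(p/eta) g^p, and the outer exponent r/eta divided
    by p/eta is again r/p. *)
Lemma amalgam_norm_poweR p q eta (c : R) g : (0 < p)%R -> 0 < q -> (0 < eta)%R ->
  (0 <= c)%R -> measurable_fun setT g -> (forall x, 0 <= g x) ->
  amalgam_norm P Om (p / eta) (q * (eta^-1)%:E) (fun x => c%:E * g x `^ eta) =
  c%:E * amalgam_norm P Om p q g `^ eta.
Proof.
move=> p0 q0 e0 c0 mg g0.
have intE j : \int[P]_(x in Om j) (`|c%:E * g x `^ eta| `^ (p / eta)) =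
    (c `^ (p / eta))%:E * \int[P]_(x in Om j) (`|g x| `^ p).
  rewrite -ge0_integralZl//; last first.
  - by rewrite lee_fin powR_ge0.
  - by move=> x _; exact: poweR_ge0.
  - exact: measurable_abse_poweR.
  apply: eq_integral => x _.
  rewrite gee0_abs ?mule_ge0 ?poweR_ge0// gee0_abs//.
  rewrite poweRM ?poweR_ge0// poweR_EFin -poweRrM; congr (_ * _ `^ _).
  by rewrite mulrCA mulfV ?gt_eqF// mulr1.
have i0 j : 0 <= \int[P]_(x in Om j) (`|g x| `^ p).
  by apply: integral_ge0 => x _; exact: poweR_ge0.
have en0 : eta != 0%R by rewrite gt_eqF.
have pn0 : p != 0%R by rewrite gt_eqF.
case: q q0 => [r| |]// r0; last first.
  rewrite gt0_mulye ?lte_fin ?invr_gt0//=.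
  rewrite -ereal_sup_poweR//; last 2 first.
  - by move=> _ [j _ <-]; exact: poweR_ge0.
  - by eexists; exists 0%R.
  rewrite -ereal_supZl//; last by apply/set0P; eexists; eexists => //; exists 0%R.
  congr ereal_sup; rewrite !image_comp; apply: eq_imagel => j _ /=.
  rewrite intE poweRM ?lee_fin ?powR_ge0// poweR_EFin -powRrM mulfV ?mulf_neq0 ?invr_eq0//.
  by rewrite powRr1// -poweRrM invf_div mulrC.
rewrite lte_fin in r0; have rn0 : r != 0%R by rewrite gt_eqF.
rewrite -EFinM /=.
under eq_esum => j _.
  rewrite intE poweRM ?lee_fin ?powR_ge0// poweR_EFin -powRrM.
  rewrite (_ : (r / eta) / (p / eta) = r / p)%R; last by field; rewrite en0 pn0.
  rewrite (_ : (p / eta) * (r / p) = r / eta)%R; last by field; rewrite en0 pn0.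
  over.
rewrite esumZl ?powR_ge0//; last by move=> j; exact: poweR_ge0.
rewrite poweRM ?lee_fin ?powR_ge0//; last by apply: esum_ge0 => j _; exact: poweR_ge0.
rewrite poweR_EFin -powRrM mulfV ?mulf_neq0 ?invr_eq0// powRr1// -poweRrM.
by rewrite invf_div (mulrC r^-1%R).
Qed.

Lemma amalgam_normZ p q (c : R) g : (0 < p)%R -> 0 < q ->
  (0 <= c)%R -> measurable_fun setT g -> (forall x, 0 <= g x) ->
  amalgam_norm P Om p q (fun x => c%:E * g x) = c%:E * amalgam_norm P Om p q g.
Proof.
move=> p0 q0 c0 mg g0; have := amalgam_norm_poweR p0 q0 ltr01 c0 mg g0.
rewrite invr1 mulr1 mule1 poweRe1 ?amalgam_norm_ge0// => <-.
by congr amalgam_norm; apply/funext => x; rewrite poweRe1.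
Qed.

Lemma amalgam_norm_lty p q f : (0 < p)%R -> 0 < q ->
  amalgam_norm P Om p q f < +oo -> forall j, \int[P]_(x in Om j) (`|f x| `^ p) < +oo.
Proof.
move=> p0 q0 + j; case: q q0 => [r| |]//= r0.
  rewrite lte_fin in r0 => /lty_poweRy; rewrite invr_eq0 gt_eqF// => /(_ isT) h.
  apply: (@lty_poweRy _ _ (r / p)); first by rewrite mulf_neq0 ?invr_eq0 ?gt_eqF.
  apply: le_lt_trans h.
  apply: (@le_esum_term _ _ (fun j => (\int[P]_(x in Om j) (`|f x| `^ p)) `^ (r / p))).
  by move=> i; exact: poweR_ge0.
move=> h; apply: (@lty_poweRy _ _ p^-1); first by rewrite invr_eq0 gt_eqF.
by apply: le_lt_trans h; apply: ereal_sup_ubound; exists j.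
Qed.

(** The countably many [Om j] cover the space, so one null set for each of them suffices. *)
Lemma ae_amalgam (Q : T -> Prop) : (forall j, {ae P, forall x, Om j x -> Q x}) ->
  {ae P, forall x, Q x}.
Proof.
move=> /ae_forall_int; apply: filterS => x Hx.
have : setT x by []; rewrite -covOm => -[j _ Omj].
exact: Hx Omj.
Qed.

Lemma amalgam_norm_ae_lty p q f : (0 < p)%R -> 0 < q -> measurable_fun setT f ->
  amalgam_norm P Om p q f < +oo -> {ae P, forall x, `|f x| < +oo}.
Proof.
move=> p0 q0 mf fy; apply: ae_amalgam => j.
have ij : P.-integrable (Om j) (fun x => `|f x| `^ p).
  apply/integrableP; split; first exact: measurable_abse_poweR.
  under eq_integral do rewrite gee0_abs ?poweR_ge0//.
  exact: (amalgam_norm_lty p0 q0 fy).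
apply: filterS (integrable_ae (mOm j) ij) => x /= h /h.
rewrite ge0_fin_numE ?poweR_ge0//; apply: lty_poweRy.
by rewrite gt_eqF.
Qed.

(** Dominated convergence is applied twice: to the integrals over each [Om j], with dominating
    function |g|^p, and then to the sum over j. The second application is what requires a finite
    outer exponent. *)
Lemma amalgam_norm_cvg0 p r (f : nat -> T -> \bar R) g : (0 < p)%R -> (0 < r)%R ->
  (forall n, measurable_fun setT (f n)) -> measurable_fun setT g ->
  (forall n x, 0 <= f n x <= g x) -> amalgam_norm P Om p r%:E g < +oo ->
  {ae P, forall x, f ^~ x @ \oo --> 0} ->
  forall e : R, (0 < e)%R -> \forall n \near \oo, amalgam_norm P Om p r%:E (f n) <= e%:E.
Proof.
move=> p0 r0 mf mg fg gy f0 e e0.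
have f_ge0 n x : 0 <= f n x by case/andP: (fg n x).
have f_le n x : f n x <= g x by case/andP: (fg n x).
have g_ge0 x : 0 <= g x by apply: le_trans (f_le 0%N x).
have i0 h j : 0 <= \int[P]_(x in Om j) (`|h x| `^ p).
  by apply: integral_ge0 => x _; exact: poweR_ge0.
have le_pow n x : `|f n x| `^ p <= `|g x| `^ p.
  by apply: le_poweR => //; [exact: ltW | rewrite !gee0_abs].
have inner j : (fun n => \int[P]_(x in Om j) (`|f n x| `^ p)) @ \oo --> 0.
  have := @dominated_convergence _ T R P (Om j) (mOm j)
    (fun n x => `|f n x| `^ p) (cst 0) (fun x => `|g x| `^ p).
  case.
  - by move=> n; exact: measurable_abse_poweR.
  - exact: measurable_cst.
  - apply: filterS f0 => x fx _; apply: poweR_cvg0 => //.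
    by under eq_fun do rewrite gee0_abs//.
  - apply/integrableP; split; first exact: measurable_abse_poweR.
    under eq_integral do rewrite gee0_abs ?poweR_ge0//.
    by apply: (amalgam_norm_lty p0 _ gy); rewrite lte_fin.
  - by apply: aeW => x n _; rewrite gee0_abs ?poweR_ge0.
  by move=> _ _; rewrite integral0.
have := @esum_dominated_cvg0 R int
  (fun n j => (\int[P]_(x in Om j) (`|f n x| `^ p)) `^ (r / p))
  (fun j => (\int[P]_(x in Om j) (`|g x| `^ p)) `^ (r / p)).
move=> H0; have H := fun h1 h2 h3 => H0 h1 h2 h3 (e `^ r)%R (powR_gt0 r e0).
have {H} : \forall n \near \oo,
    \esum_(j in [set: int]) (\int[P]_(x in Om j) (`|f n x| `^ p)) `^ (r / p) <= (e `^ r)%:E.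
  apply: H.
  - move=> n j; rewrite poweR_ge0/=; apply: le_poweR => //.
      by rewrite divr_ge0// ltW.
    apply: ge0_le_integral => //.
    + by move=> x _; exact: poweR_ge0.
    + exact: measurable_abse_poweR.
    + exact: measurable_abse_poweR.
  - by move: gy => /= /lty_poweRy; apply; rewrite invr_eq0 gt_eqF.
  - by move=> j; apply: poweR_cvg0 => //; rewrite divr_gt0.
apply: filterS => n /= Hn.
rewrite -[leRHS]poweRe1; last by rewrite lee_fin ltW.
rewrite -(mulfV (lt0r_neq0 r0)) poweRrM poweR_EFin /= -poweR_EFin.
apply: le_poweR => //; first by rewrite invr_ge0 ltW.
by apply: esum_ge0 => j _; exact: poweR_ge0.
Qed.

End amalgam.

(** * A common size functional for the square function and the modulus *)

Section ksize.
Context (R : realType).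
Implicit Types (k : hardy_kind) (a b : nat -> R) (n : nat).

(* The square function, resp. the modulus, at time [n] of a process with increments [a]. *)
Definition ksize k a n : R :=
  match k with
  | Square => Num.sqrt (\sum_(i < n) a i ^+ 2)
  | Maximal => `|\sum_(i < n) a i|
  end.

Lemma ksize_ge0 k a n : 0 <= ksize k a n.
Proof. by case: k => /=; rewrite ?sqrtr_ge0. Qed.

Lemma ksize0 k a : ksize k a 0 = 0.
Proof. by case: k; rewrite /= big_ord0 ?sqrtr0 ?normr0. Qed.

Lemma eq_ksize k a b n : (forall i, (i < n)%N -> a i = b i) -> ksize k a n = ksize k b n.
Proof.
by move=> ab; case: k => /=; congr (_ _); apply: eq_bigr => i _; rewrite ab.
Qed.

Lemma ksizeZ k (c : R) a n : ksize k (fun i => c * a i) n = `|c| * ksize k a n.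
Proof.
case: k => /=; last by rewrite -mulr_sumr normrM.
under eq_bigr do rewrite exprMn.
by rewrite -mulr_sumr sqrtrM ?sqr_ge0// sqrtr_sqr.
Qed.

Lemma ksizeN k a n : ksize k (fun i => - a i) n = ksize k a n.
Proof.
by under eq_ksize do rewrite -mulN1r; rewrite ksizeZ normrN1 mul1r.
Qed.

(** For [Square] this is the Minkowski inequality, obtained from Cauchy-Schwarz. With s, t the two
    Euclidean norms and C the inner product, 2st(st - C) is the sum of the squares (t a_i - s
    b_i)^2; when st = 0 one of the sequences vanishes. *)
Lemma ler_ksizeD k a b n : ksize k (fun i => a i + b i) n <= ksize k a n + ksize k b n.
Proof.
case: k => /=; last by rewrite big_split ler_normD.
set A := \sum_(i < n) a i ^+ 2; set B := \sum_(i < n) b i ^+ 2.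
have A0 : 0 <= A by apply: sumr_ge0 => i _; rewrite sqr_ge0.
have B0 : 0 <= B by apply: sumr_ge0 => i _; rewrite sqr_ge0.
set s := Num.sqrt A; set t := Num.sqrt B.
have s2 : s ^+ 2 = A by rewrite sqr_sqrtr.
have t2 : t ^+ 2 = B by rewrite sqr_sqrtr.
have [s0 t0] : 0 <= s /\ 0 <= t by rewrite !sqrtr_ge0.
pose C := \sum_(i < n) a i * b i.
have CS : C <= s * t.
  have key : 0 <= 2 * (s * t) * (s * t - C).
    have -> : 2 * (s * t) * (s * t - C) = \sum_(i < n) (t * a i - s * b i) ^+ 2.
      transitivity (t ^+ 2 * A + s ^+ 2 * B - 2 * (s * t) * C).
        by rewrite -s2 -t2; ring.
      rewrite /A /B /C !mulr_sumr -big_split/= -sumrB.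
      by apply: eq_bigr => i _; ring.
    by apply: sumr_ge0 => i _; rewrite sqr_ge0.
  have [st0|st0] := ltP 0 (s * t).
    by move: key; rewrite pmulr_rge0 ?subr_ge0// mulr_gt0.
  have /eqP : s * t = 0 by apply/eqP; rewrite eq_le st0 mulr_ge0.
  rewrite mulf_eq0 => /orP[] /eqP z0.
    have /psumr_eq0P Az : A = 0 by rewrite -s2 z0 expr0n.
    rewrite z0 mul0r /C big1// => i _; have /eqP := Az (fun i _ => sqr_ge0 _) i isT.
    by rewrite sqrf_eq0 => /eqP ->; rewrite mul0r.
  have /psumr_eq0P Bz : B = 0 by rewrite -t2 z0 expr0n.
  rewrite z0 mulr0 /C big1// => i _; have /eqP := Bz (fun i _ => sqr_ge0 _) i isT.
  by rewrite sqrf_eq0 => /eqP ->; rewrite mulr0.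
rewrite -[leRHS]ger0_norm ?addr_ge0// -sqrtr_sqr ler_sqrt ?sqr_ge0//.
have -> : \sum_(i < n) (a i + b i) ^+ 2 = A + C *+ 2 + B.
  by rewrite /A /B /C -sumrMnl -!big_split; apply: eq_bigr => i _; rewrite /= sqrrD.
by rewrite sqrrD s2 t2 lerD2r lerD2l lerMn2r.
Qed.

Lemma ler_ksizeB k a b n : ksize k (fun i => a i - b i) n <= ksize k a n + ksize k b n.
Proof. by rewrite (le_trans (ler_ksizeD _ _ _ _))// ksizeN. Qed.

(** The factor 2 comes from [Maximal], where an increment is a difference of two partial sums. *)
Lemma increment_le_ksize k a n (M : R) : (forall n, ksize k a n <= M) ->
  `|a n| <= 2 * M.
Proof.
move=> aM; have M0 : 0 <= M by rewrite -(ksize0 k a).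
case: k aM => /= aM.
  apply: (@le_trans _ _ M); last by rewrite ler_peMl// ler1n.
  apply: le_trans (aM n.+1); rewrite -sqrtr_sqr ler_wsqrtr// big_ord_recr/= lerDr.
  by apply: sumr_ge0 => i _; rewrite sqr_ge0.
have -> : a n = \sum_(i < n.+1) a i - \sum_(i < n) a i by rewrite big_ord_recr/= addrC addrK.
by rewrite mulr_natl mulr2n; apply: le_trans (ler_normB _ _) _; exact: lerD (aM n.+1) (aM n).
Qed.

Variables (k : hardy_kind) (a b : nat -> R).
Hypothesis b0 : forall n, 0 <= b n.
Hypothesis bS : forall n, b n <= b n.+1.
Hypothesis ab : forall n, ksize k a n.+1 <= b n.

Let b_nd m n : (m <= n)%N -> b m <= b n.
Proof. by move: m n; apply/nondecreasing_seqP. Qed.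

(** Here [j] is the first passage of [b] above [c], capped at [n]: discarding the increments with
    b_i > c is the same as stopping at [j]. *)
Lemma prefix_of_nondecreasing (c : R) n :
  exists2 j, (j <= n)%N & forall i, (i < n)%N -> (b i <= c) = (i < j)%N.
Proof.
elim: n => [|n [j jn IH]]; first by exists 0%N.
have [bc|cb] := leP (b n) c.
  by exists n.+1 => // i ni; rewrite ni; apply: le_trans bc; exact: b_nd.
exists j; first exact: leqW.
move=> i; rewrite ltnS leq_eqVlt => /predU1P[->|]; last exact: IH.
by rewrite leNgt cb ltnNge jn.
Qed.

(* Truncating the increments where [b] exceeds a level amounts to stopping the process. *)
Lemma ksize_trunc (c : R) n : 0 <= c ->
  ksize k (fun i => a i * (b i <= c)%R%:R) n.+1 <= Num.min (b n) c.
Proof.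
move=> c0; have [j jn bj] := prefix_of_nondecreasing c n.+1.
have -> : ksize k (fun i => a i * (b i <= c)%R%:R) n.+1 = ksize k a j.
  have H (w : nat -> R) : (forall i, (j <= i < n.+1)%N -> w i = 0) ->
      \sum_(i < n.+1) w i = \sum_(i < j) w i.
    move=> w0; rewrite -(subnKC jn) big_split_ord/= [X in _ + X]big1 ?addr0// => i _.
    by rewrite w0// leq_addr/= -[X in (_ < X)%N](subnKC jn) ltn_add2l.
  have L (w : R -> R) : w 0 = 0 -> \sum_(i < n.+1) w (a i * (b i <= c)%R%:R) =
      \sum_(i < j) w (a i).
    move=> w0; rewrite (H (fun i => w (a i * (b i <= c)%R%:R))).
      apply: eq_bigr => i _; rewrite bj ?ltn_ord ?mulr1//.
      exact: leq_trans (ltn_ord i) jn.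
    by move=> i /andP[ji iN]; rewrite bj// ltnNge ji mulr0.
  case: k; first by rewrite /= (L (fun y => y ^+ 2)) ?expr0n.
  by rewrite /= (L id).
case: j jn bj => [_ _|j jn bj]; first by rewrite ksize0 le_min b0.
apply: (le_trans (ab j)); rewrite le_min b_nd//=.
by rewrite bj.
Qed.

Lemma ksize_trunc_le (c : R) n : 0 <= c -> ksize k (fun i => a i * (b i <= c)%R%:R) n <= c.
Proof.
move=> c0; case: n => [|n]; first by rewrite ksize0.
by apply: (le_trans (ksize_trunc _ c0)); rewrite ge_min lexx orbT.
Qed.

Lemma ksize_band (u v : R) n : 0 <= u -> u <= v ->
  ksize k (fun i => a i * ((b i <= v)%R%:R - (b i <= u)%R%:R)) n <= 2 * v.
Proof.
move=> u0 uv; have v0 := le_trans u0 uv.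
under eq_ksize do rewrite mulrBr.
rewrite (le_trans (ler_ksizeB _ _ _ _))// mulr_natl mulr2n lerD ?ksize_trunc_le//.
by apply: le_trans uv; exact: ksize_trunc_le.
Qed.

(** What remains after removing the band u < b_i <= v. As long as b_n <= v, only the increments with
    b_i <= u survive; afterwards the triangle inequality gives b_n + v + u, at most 3 b_n. *)
Lemma ksize_remainder (u v : R) n : 0 <= u -> u <= v ->
  ksize k (fun i => a i * (1 - ((b i <= v)%R%:R - (b i <= u)%R%:R))) n.+1 <=
  if b n <= v then Num.min (b n) u else 3 * b n.
Proof.
move=> u0 uv; have v0 := le_trans u0 uv; case: ifPn => [bv|].
  (* Since b_i <= b_n <= v for all i <= n, the multiplier reduces to the indicator of b_i <= u. *)
  rewrite -[leLHS](_ : ksize k (fun i => a i * (b i <= u)%R%:R) n.+1 = _).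
    exact: ksize_trunc.
  apply: eq_ksize => i; rewrite ltnS => /b_nd/le_trans/(_ bv) ->.
  by rewrite opprB addrCA subrr addr0.
rewrite -ltNge => vb.
have -> : ksize k (fun i => a i * (1 - ((b i <= v)%R%:R - (b i <= u)%R%:R))) n.+1 =
    ksize k (fun i => (a i - a i * (b i <= v)%R%:R) + a i * (b i <= u)%R%:R) n.+1.
  by apply: eq_ksize => i _; ring.
rewrite (le_trans (ler_ksizeD _ _ _ _))//.
have := ler_ksizeB k a (fun i => a i * (b i <= v)%R%:R) n.+1.
have := ab n; have := ksize_trunc_le n.+1 v0; have := ksize_trunc_le n.+1 u0.
by lra.
Qed.

(** If b_i = 0 then b_{i-1} = 0 as well, so the size vanishes at both times i and i + 1. Such
    increments lie in no dyadic band, and this is why nothing is lost. *)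
Lemma increment_eq0 i : b i = 0 -> a i = 0.
Proof.
move=> bi0.
have [c0 c1] : (forall n, (n <= i)%N -> b n <= 0) /\ ksize k a i <= 0.
  split=> [n ni|]; first by rewrite -bi0 b_nd.
  by case: i bi0 => [|j] bj; [rewrite ksize0 | rewrite -bj (le_trans (ab j))// b_nd].
have c2 : ksize k a i.+1 <= 0 by rewrite -bi0.
have z1 : ksize k a i = 0 by apply/eqP; rewrite eq_le c1 ksize_ge0.
have z2 : ksize k a i.+1 = 0 by apply/eqP; rewrite eq_le c2 ksize_ge0.
case: k z1 z2 => /= [_ /eqP|/eqP].
  rewrite sqrtr_eq0 big_ord_recr/= => h; apply/eqP; rewrite -sqrf_eq0 eq_le sqr_ge0 andbT.
  apply: le_trans h; rewrite lerDr; apply: sumr_ge0 => j _; exact: sqr_ge0.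
by rewrite normr_eq0 => /eqP s1 /eqP; rewrite normr_eq0 big_ord_recr/= s1 add0r => /eqP.
Qed.

End ksize.

Section ksize_process.
Context (R : realType) (T : Type).
Implicit Types (f : nat -> T -> R) (k : hardy_kind).

(** This is d_{i+1} f, indexed so that increment [i] is governed by [b i], which is known at time
    [i]. *)
Definition incr f x i : R := f i.+1 x - f i x.

Lemma sum_incr f x n : f 0%N x = 0 -> \sum_(i < n) incr f x i = f n x.
Proof.
move=> f0; rewrite -(big_mkord xpredT (incr f x)) telescope_sumr//.
by rewrite f0 subr0.
Qed.

Lemma sqfun_nE f n x : sqfun_n f n x = ksize Square (incr f x) n.
Proof.
rewrite /sqfun_n /= big_add1/= big_mkord; congr Num.sqrt.
by apply: eq_bigr => i _; rewrite real_normK ?num_real.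
Qed.

Lemma norm_ksize f n x : f 0%N x = 0 -> `|f n x| = ksize Maximal (incr f x) n.
Proof. by move=> f0; rewrite /= sum_incr. Qed.

Let sqfunE f x : sqfun f x = ((\sum_(i <oo) ((incr f x i) ^+ 2)%:E) `^ 2^-1)%E.
Proof.
rewrite /sqfun; congr (_ `^ _)%E.
rewrite -(@nneseries_addn _ _ 1)//.
by apply: eq_eseriesr => i _; rewrite addn1 real_normK ?num_real.
Qed.

Lemma ksize_le_atom_fun k f n x : f 0%N x = 0 ->
  ((ksize k (incr f x) n)%:E <= atom_fun k f x)%E.
Proof.
move=> f0; case: k => /=; last first.
  by apply: ereal_sup_ubound; exists n => //; rewrite sum_incr.
rewrite sqfunE -powR12_sqrt; last by apply: sumr_ge0 => i _; rewrite sqr_ge0.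
rewrite -poweR_EFin; apply: le_poweR => //.
  by rewrite lee_fin; apply: sumr_ge0 => i _; rewrite sqr_ge0.
rewrite -(big_mkord xpredT (fun i => incr f x i ^+ 2)) -sumEFin.
by apply: nneseries_lim_ge => *; rewrite lee_fin sqr_ge0.
Qed.

Lemma atom_fun_le k f x (C : R) : f 0%N x = 0 -> (forall n, ksize k (incr f x) n <= C) ->
  (atom_fun k f x <= C%:E)%E.
Proof.
move=> f0 fC; have C0 : 0 <= C by rewrite -(ksize0 k (incr f x)).
case: k fC => /= fC; last first.
  by apply: ge_ereal_sup => _ [n _ <-]; rewrite lee_fin -(sum_incr n f0); exact: fC.
rewrite sqfunE.
have -> : C%:E = (((C ^+ 2)%:E) `^ 2^-1)%E.
  by rewrite poweR_EFin powR12_sqrt ?sqr_ge0// sqrtr_sqr ger0_norm.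
apply: le_poweR => //.
  by apply: nneseries_ge0 => *; rewrite lee_fin sqr_ge0.
apply: lime_le; first by apply: is_cvg_nneseries => *; rewrite lee_fin sqr_ge0.
apply: nearW => n; rewrite sumEFin lee_fin big_mkord.
rewrite -[leLHS]sqr_sqrtr; last by apply: sumr_ge0 => i _; rewrite sqr_ge0.
by rewrite lerXn2r ?nnegrE ?sqrtr_ge0//; exact: fC.
Qed.

End ksize_process.

(** Merges the two kinds and puts all times under a single null set; f_0 = 0 makes |f_n| the modulus
    of a sum of increments. *)
Lemma dominatesP d (T : measurableType d) (R : realType) (P : probability T R)
    (k : hardy_kind) (f b : nat -> T -> R) : {ae P, forall x, f 0%N x = 0} ->
  dominates P k f b <->
  {ae P, forall x, forall n, ksize k (incr f x) n.+1 <= b n x}.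
Proof.
move=> f0; case: k; (split=> [H|H]; [apply/ae_foralln|]) => n.
- by apply: filterS (H n) => x; rewrite sqfun_nE.
- by apply: filterS H => x; rewrite sqfun_nE.
- by apply: filterS2 f0 (H n) => x fx; rewrite (norm_ksize _ fx).
- by apply: filterS2 f0 H => x fx; rewrite (norm_ksize _ fx).
Qed.

(** * Predictable majorants, attainment of the norm, martingale increments *)

Section predictable.
Context d (T : measurableType d) (R : realType) (F : nat -> set (set T)).
Implicit Types b : nat -> T -> R.

Lemma predictable_nd b x m n : predictable_seq F b -> (m <= n)%N -> b m x <= b n x.
Proof.
by case=> _ bS _; move: m n; apply/(nondecreasing_seqP (fun n => b n x)) => n; exact: bS.
Qed.

Lemma seq_limitE b x : predictable_seq F b ->
  seq_limit b x = ereal_sup (range (fun n => (b n x)%:E)).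
Proof.
move=> pb; apply/cvg_lim => //; apply: ereal_nondecreasing_cvgn.
by move=> m n mn; rewrite lee_fin; exact: predictable_nd pb mn.
Qed.

Lemma seq_limit_ge b x n : predictable_seq F b -> ((b n x)%:E <= seq_limit b x)%E.
Proof. by move=> pb; rewrite seq_limitE//; apply: ereal_sup_ubound; exists n. Qed.

Lemma seq_limit_le b x (C : \bar R) : predictable_seq F b ->
  (forall n, (b n x)%:E <= C)%E -> (seq_limit b x <= C)%E.
Proof. by move=> pb bC; rewrite seq_limitE//; apply: ge_ereal_sup => _ [n _ <-]. Qed.

Lemma seq_limit_ge0 b x : predictable_seq F b -> (0 <= seq_limit b x)%E.
Proof.
move=> pb; apply: le_trans (seq_limit_ge x 0 pb).
by case: pb => b0 _ _; rewrite lee_fin.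
Qed.

Hypothesis hF : filtration F.

Lemma measurable_predictable b n : predictable_seq F b -> measurable_fun setT (b n).
Proof.
case=> _ _ mb.
exact: (measurable_wrtW (filtration_sigma n hF) (@filtration_sub _ _ F n hF) (@mb n)).
Qed.

Lemma measurable_seq_limit b : predictable_seq F b -> measurable_fun setT (seq_limit b).
Proof.
move=> pb; apply: (@emeasurable_fun_cvg _ _ _ _ (fun n x => (b n x)%:E)).
  by move=> n; apply/measurable_EFinP; exact: measurable_predictable.
move=> x _; rewrite seq_limitE//; apply: ereal_nondecreasing_cvgn.
by move=> m n mn; rewrite lee_fin; exact: predictable_nd pb mn.
Qed.

Lemma measurable_wrt_cst (G : set (set T)) (c : R) : measurable_wrt G (fun=> c).
Proof. exact: measurable_cst. Qed.

(* [t <= v] selects the two branches so that the bound is monotone in [t] when [u <= v]. *)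
Definition remainder_bound (u v t : R) : R := if t <= v then Num.min t u else 3 * t.

Lemma predictable_remainder b u v : 0 <= u -> u <= v -> predictable_seq F b ->
  predictable_seq F (fun n x => remainder_bound u v (b n x)).
Proof.
move=> u0 uv [b0 bS mb]; split.
- move=> n x; rewrite /remainder_bound; case: ifP => _; first by rewrite le_min b0.
  by rewrite mulr_ge0.
- move=> n x; have bn := bS n x; have bn0 := b0 n x.
  rewrite /remainder_bound; case: (leP (b n.+1 x) v) => h.
    rewrite (le_trans bn h) le_min ge_min bn/= ge_min lexx orbT//.
  case: ifP => _; last by rewrite ler_pM2l.
  rewrite ge_min; apply/orP; left; apply: le_trans bn _.
  by rewrite ler_peMl ?ler1n// (le_trans bn0 bn).
- move=> n; apply: measurable_fun_ifT.
  + apply: measurable_fun_ler; first exact: mb.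
    exact: measurable_wrt_cst.
  + apply: measurable_minr; first exact: mb.
    exact: measurable_wrt_cst.
  + apply: measurable_funM; last exact: mb.
    exact: measurable_wrt_cst.
Qed.

End predictable.

Section norm_attained.
Context d (T : measurableType d) (R : realType) (P : probability T R).
Variables (F : nat -> set (set T)) (Om : int -> set T).
Hypotheses (hF : filtration F) (hOm : amalgam_partition Om).
Variables (k : hardy_kind) (p : R) (q : \bar R) (f : nat -> T -> R).
Hypotheses (p0 : 0 < p) (q0 : (0 < q)%E) (f0 : {ae P, forall x, f 0%N x = 0}).

(* The pointwise infimum of a minimizing sequence is admissible. *)
Lemma hardy_norm_attained : admissible P F Om k p q f !=set0 ->
  exists2 b, admissible P F Om k p q f b &
    (amalgam_norm P Om p q (seq_limit b) <= hardy_norm P F Om k p q f)%E.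
Proof.
move=> [b1 Ab1]; rewrite /hardy_norm; set S := [set _ | _ in _].
have [v Sv vS] : {v : (\bar R)^nat | forall i, S (v i) & v @ \oo --> ereal_inf S}.
  by apply: ereal_inf_seq; apply/set0P; exists (amalgam_norm P Om p q (seq_limit b1)), b1.
have /choice[B AB] i : exists b, admissible P F Om k p q f b /\
    amalgam_norm P Om p q (seq_limit b) = v i.
  by have [b Ab bv] := Sv i; exists b.
have pB i : predictable_seq F (B i) by case: (AB i) => -[].
have B0 i n x : 0 <= B i n x by case: (pB i).
have lbB n x : has_lbound (range (fun i => B i n x)) by exists 0 => _ [i _ <-].
pose b n x := inf (range (fun i => B i n x)).
have bB i n x : b n x <= B i n x by apply: ge_inf => //; exists i.
have geb n x (c : R) : (forall i, c <= B i n x) -> c <= b n x.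
  by move=> cB; apply: lb_le_inf => [|_ [i _ <-]//]; exists (B 0%N n x), 0%N.
have pb : predictable_seq F b.
  split=> [n x|n x|n]; first exact: geb.
    by apply: geb => i; apply: le_trans (bB i n x) _; exact: predictable_nd.
  (* The tail infimum from index 0 is the infimum of the whole sequence, and its measurability for
     [F n] is known. *)
  have -> : b n = (fun x => infs (fun i => B i n x) 0).
    apply/funext => x; rewrite /b /infs /sdrop/=; congr inf.
    by apply/seteqP; split=> _ [i _ <-]; exists i.
  apply: (@measurable_fun_infs _ (g_sigma_algebraType (F n)) R setT (fun i => B i n) 0).
    by move=> x _; exact: lbB.
  by move=> i; case: (pB i) => _ _; exact.
have leb i : (amalgam_norm P Om p q (seq_limit b) <= v i)%E.
  rewrite -(AB i).2; apply: le_amalgam_norm => //; first by case: hOm.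
  - exact: (measurable_seq_limit hF pb).
  - exact: (measurable_seq_limit hF (pB i)).
  - move=> x; rewrite !gee0_abs ?(seq_limit_ge0 _ (F := F))//.
    apply: (seq_limit_le pb) => n; apply: le_trans (seq_limit_ge x n (pB i)).
    by rewrite lee_fin.
exists b; last first.
  by apply: (cvge_ge _ vS); exact: nearW.
split => //.
  apply/(dominatesP _ _ f0).
  have : {ae P, forall x, forall i n, ksize k (incr f x) n.+1 <= B i n x}.
    apply/ae_foralln => i; apply/(dominatesP _ _ f0).
    by case: (AB i) => -[].
  by apply: filterS => x H n; apply: geb.
split; first exact: (measurable_seq_limit hF pb).
apply: le_lt_trans (leb 0%N) _; rewrite -(AB 0%N).2.
by case: (AB 0%N) => -[_ _ []].
Qed.

End norm_attained.

Section martingale_differences.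
Context d (T : measurableType d) (R : realType) (P : probability T R).
Variables (F : nat -> set (set T)) (f : nat -> T -> R).
Hypotheses (hF : filtration F) (mf : martingale0 P F f).

Lemma martingale_is_cexp n : is_cexp P (F n) (f n.+1) (f n).
Proof.
have [mf1 intf fE _] := mf.
have sF := filtration_sigma n hF; have FS := @filtration_sub _ _ F n hF.
apply: (is_cexp_aeq_r FS _ _ (fE n)) => //.
  exact: (measurable_wrtW sF FS (@mf1 n)).
exact: cexpP.
Qed.

Lemma measurable_incr n : measurable_wrt (F n.+1) (incr f ^~ n).
Proof.
have [mf1 _ _ _] := mf; apply: measurable_funB; first exact: mf1.
exact: (measurable_wrt_le hF (leqnSn n) (@mf1 n)).
Qed.

Lemma integrable_incr n : P.-integrable setT (fun x => (incr f x n)%:E).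
Proof.
have [_ intf _ _] := mf.
under eq_fun do rewrite /incr EFinB.
exact: (integrableB measurableT (intf n.+1) (intf n)).
Qed.

Lemma integral_incr n A : F n A -> (\int[P]_(x in A) (incr f x n)%:E = 0)%E.
Proof.
move=> FA; have mA := filtration_sub hF FA; have [_ intf _ _] := mf.
have [_ _ /(_ _ FA) cE] := martingale_is_cexp n.
rewrite integralB_EFin//; try exact: integrableS (intf _).
by rewrite -cE subee// integrable_fin_num//; exact: integrableS (intf _).
Qed.

Lemma integral_incr_indic n A B : F n A -> F n B ->
  (\int[P]_(x in A) (incr f x n * \1_B x)%:E = 0)%E.
Proof.
move=> FA FB; have FAB : F n (A `&` B).
  by rewrite -(measurable_g_sigmaE (filtration_sigma n hF)); apply: measurableI;
    rewrite (measurable_g_sigmaE (filtration_sigma n hF)).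
rewrite -(integral_incr FAB) [RHS]integral_mkcondr; apply: eq_integral => x _.
by rewrite patchE indicE; case: ifPn; rewrite ?mulr1 ?mulr0.
Qed.

End martingale_differences.

(** * Two-sided sums and dyadic levels *)

Section zsum_lemmas.
Variable V : zmodType.

Lemma zsum_telescope (w : int -> V) lm :
  zsum (fun k => w (k + 1) - w k) lm = w (lm.2%:Z + 1) - w (- lm.1%:Z).
Proof.
case: lm => l m; rewrite /zsum/=.
have H n : \sum_(i < n) (w (i%:Z - l%:Z + 1) - w (i%:Z - l%:Z)) = w (n%:Z - l%:Z) - w (- l%:Z).
  elim: n => [|n IH]; first by rewrite big_ord0 add0r subrr.
  rewrite big_ord_recr/= IH addrC addrA; congr (_ - _).
  by rewrite -addrA addNr addr0 addrAC -PoszD addn1.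
by rewrite H; congr (w _ - _); rewrite -addn1 !PoszD; lia.
Qed.

End zsum_lemmas.

Section dyadic.
Variable R : realType.

Definition dyad (m : int) : R := 2 `^ m%:~R.

Lemma dyad_gt0 m : 0 < dyad m. Proof. by rewrite powR_gt0. Qed.

Lemma dyadS m : dyad (m + 1) = 2 * dyad m.
Proof. by rewrite /dyad intrD powRD ?pnatr_eq0 ?implybT// powRr1// mulrC. Qed.

Lemma le_dyad m n : m <= n -> dyad m <= dyad n.
Proof. by move=> mn; rewrite /dyad ler_powR ?ler1n// ler_int. Qed.

Lemma dyad_ge (t : R) : exists M : nat, forall m : nat, (M <= m)%N -> t <= dyad m%:Z.
Proof.
exists (Num.Def.truncn t).+1 => m Mm; apply: (@le_trans _ _ m%:R).
  have [t0|t0] := leP t 0; first exact: le_trans t0 _.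
  by apply: (@le_trans _ _ (Num.Def.truncn t).+1%:R); [rewrite ltW// truncnS_gt | rewrite ler_nat].
rewrite /dyad -pmulrn powR_mulrn// -natrX ler_nat.
by rewrite ltnW// ltn_expl.
Qed.

Lemma dyad_lt (t : R) : 0 < t -> exists L : nat, forall l : nat, (L <= l)%N -> dyad (- l%:Z) < t.
Proof.
move=> t0; have [M HM] := dyad_ge (2 / t); exists M => l /HM.
rewrite {2}/dyad intrN powRN -/(dyad l%:Z) ler_pdivrMr// => h.
rewrite -[ltLHS]mul1r ltr_pdivrMr ?dyad_gt0//.
by rewrite mulrC; apply: lt_le_trans h; rewrite ltr1n.
Qed.

Definition lvl (m : int) (t : R) : R := (t <= dyad m)%R%:R.

Lemma two_sidedP (Q : nat * nat -> Prop) :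
  (exists N, forall l m, (N <= l)%N -> (N <= m)%N -> Q (l, m)) ->
  \forall lm \near two_sided, Q lm.
Proof.
move=> [N HN]; exists ([set l | (N <= l)%N], [set m | (N <= m)%N]).
  by split; exact: nbhs_infty_ge.
by move=> [l m] /= [Nl Nm]; exact: HN.
Qed.

(** Among finitely many increments, those with b_i > 0 have b_i in ]2^-l, 2^(m+1)] once l and m are
    large, and those with b_i = 0 vanish. Hence at each fixed time the partial sums of the
    decomposition become constant. *)
Lemma band_eventually (a : nat -> R) (b : nat -> R) n :
  (forall i, 0 <= b i) -> (forall i, b i = 0 -> a i = 0) ->
  exists N, forall l m, (N <= l)%N -> (N <= m)%N -> forall i, (i < n)%N ->
    a i * (lvl (m%:Z + 1) (b i) - lvl (- l%:Z) (b i)) = a i.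
Proof.
move=> b0 ab; elim: n => [|n [N IH]]; first by exists 0%N.
have [bz|bn] := eqVneq (b n) 0.
  exists N => l m Nl Nm i; rewrite ltnS leq_eqVlt => /predU1P[->|]; last exact: IH.
  by rewrite ab// mul0r.
have bn0 : 0 < b n by rewrite lt_def bn b0.
have [M HM] := dyad_ge (b n); have [L HL] := dyad_lt bn0.
exists (maxn N (maxn M L)) => l m; rewrite !geq_max => /and3P[Nl _ Ll] /and3P[Nm Mm _] i.
rewrite ltnS leq_eqVlt => /predU1P[->|]; last exact: IH.
have h1 : (b n <= dyad (- l%:Z)) = false by apply/lt_geF/HL.
have h2 : b n <= dyad (m%:Z + 1).
  by apply: le_trans (HM m Mm) _; apply: le_dyad; rewrite lerDl.
by rewrite /lvl h1 h2 subr0 mulr1.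
Qed.

End dyadic.

Lemma two_sided_filter : Filter two_sided.
Proof. exact: filter_prod_filter. Qed.

Section is_cexp_sum.
Context d (T : measurableType d) (R : realType) (P : probability T R).
Variable G : set (set T).
Hypothesis (sG : sigma_algebra setT G) (GF : G `<=` measurable).

Lemma is_cexp_sum n (c : nat -> R) (X Y : nat -> T -> R) :
  (forall i, P.-integrable setT (EFin \o X i)) -> (forall i, is_cexp P G (X i) (Y i)) ->
  P.-integrable setT (EFin \o (fun x => \sum_(i < n) c i * X i x)) /\
  is_cexp P G (fun x => \sum_(i < n) c i * X i x) (fun x => \sum_(i < n) c i * Y i x).
Proof.
move=> iX XY; elim: n => [|n [iS IH]].
  have -> : (fun x => \sum_(i < 0) c i * X i x) = fun=> 0 by apply/funext => x; rewrite big_ord0.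
  have -> : (fun x => \sum_(i < 0) c i * Y i x) = fun=> 0 by apply/funext => x; rewrite big_ord0.
  have i0 : P.-integrable setT (EFin \o (fun=> 0 : R)) by exact: integrable0.
  by split => //; split => //; exact: measurable_cst.
have E (Z : nat -> T -> R) : (fun x => \sum_(i < n.+1) c i * Z i x) =
    (fun x => 1 * (\sum_(i < n) c i * Z i x) + c n * Z n x).
  by apply/funext => x; rewrite big_ord_recr/= mul1r.
rewrite !E; split; last exact: is_cexp_lin.
have -> : EFin \o (fun x => 1 * (\sum_(i < n) c i * X i x) + c n * X n x) =
    ((fun x => (\sum_(i < n) c i * X i x)%:E) \+ (fun x => (c n)%:E * (X n x)%:E))%E.
  by apply/funext => x /=; rewrite mul1r EFinD EFinM.
by apply: integrableD => //; exact: (integrableZl measurableT (c n) (iX n)).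
Qed.

End is_cexp_sum.

(** * Stopping times and first passage times *)

Section stopping.
Context d (T : measurableType d) (R : realType) (P : probability T R).
Variables (F : nat -> set (set T)) (p : R).
Hypothesis hF : filtration F.

Lemma measurable_stop_fin (nu : T -> option nat) : stopping_time F nu ->
  measurable (stop_fin nu).
Proof.
move=> snu; rewrite (_ : stop_fin nu =
    \bigcup_n [set x | exists2 m, nu x = Some m & (m <= n)%N]).
  by apply: bigcup_measurable => n _; apply: (@filtration_sub _ _ F n hF); exact: snu.
apply/seteqP; split => [x|x [n _ [m nx _]]]; rewrite /stop_fin /=; last by rewrite nx.
by case E : (nu x) => [m|//] _; exists m => //; exists m.
Qed.

Lemma measurable_atom_sum (eta : R) (lam : int -> R) (nu : int -> T -> option nat) :
  (forall i, stopping_time F (nu i)) -> measurable_fun setT (atom_sum P p eta lam nu).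
Proof.
move=> snu; apply: emeasurable_esum_int => [i x|i].
  by rewrite lee_fin mulr_ge0// powR_ge0.
apply/measurable_EFinP/measurable_funM; first exact: measurable_cst.
by apply: measurable_indic; exact: measurable_stop_fin.
Qed.

End stopping.
Section first_hit.
Context (T : Type) (R : realType) (b : nat -> T -> R) (c : R).

(** For non-decreasing [b], the event that this time is at most n is just c < b_n, which makes it a
    stopping time when [b] is adapted. *)
Definition first_hit (x : T) : option nat :=
  if pselect (exists n, c < b n x) is left e then Some (ex_minn e) else None.

Hypothesis b_nd : forall x m n, (m <= n)%N -> b m x <= b n x.

Lemma stop_fin_first_hit x : stop_fin first_hit x <-> exists n, c < b n x.
Proof. by rewrite /stop_fin /= /first_hit; case: pselect => h; split. Qed.

Lemma first_hit_le n : [set x | exists2 m, first_hit x = Some m & (m <= n)%N] =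
  [set x | c < b n x].
Proof.
apply/seteqP; split => [x [m]|x] /=; rewrite /first_hit; case: pselect => // h.
  by case: ex_minnP => j cj _ [<-] jn; apply: lt_le_trans cj _; exact: b_nd.
  by move=> cn; exists (ex_minn h) => //; case: ex_minnP => j _; exact.
by move=> cn; case: h; exists n.
Qed.

Lemma stop_ge_first_hit n i x : stop_ge first_hit n x -> (i < n)%N -> b i x <= c.
Proof.
move=> sx ni; rewrite leNgt; apply/negP => ci; move: sx.
rewrite /stop_ge /first_hit /=; case: pselect => [h|]; last by case; exists i.
move=> /(_ _ erefl); case: ex_minnP => j _ /(_ _ ci) ji nj.
by have := leq_trans (leq_ltn_trans ji ni) nj; rewrite ltnn.
Qed.

End first_hit.

Lemma dyadic_const_gt0 (R : realType) (eta : R) : 0 < eta -> 0 < 4 `^ eta * (1 - 2 `^ (- eta))^-1.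
Proof.
move=> e0; rewrite mulr_gt0 ?powR_gt0// invr_gt0 subr_gt0 powRN invf_lt1 ?powR_gt0//.
by rewrite -ltr_ln ?posrE ?powR_gt0// ln1 ln_powR mulr_gt0// ln_gt0// ltr1n.
Qed.

(** * Part (i): the dyadic atomic decomposition *)

Section decomposition.
Context d (T : measurableType d) (R : realType) (P : probability T R).
Variables (F : nat -> set (set T)) (Om : int -> set T).
Hypotheses (hF : filtration F) (hOm : amalgam_partition Om).
Variables (k : hardy_kind) (p : R) (q : \bar R) (f b : nat -> T -> R).
Hypotheses (p0 : 0 < p) (q0 : (0 < q)%E) (mf : martingale0 P F f).
Hypothesis Ab : admissible P F Om k p q f b.

Let pb : predictable_seq F b. Proof. by case: Ab. Qed.
Let b0 n x : 0 <= b n x. Proof. by case: pb. Qed.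
Let bS n x : b n x <= b n.+1 x. Proof. by case: pb. Qed.
Let f0 : {ae P, forall x, f 0%N x = 0}. Proof. by case: mf. Qed.
Let fb : {ae P, forall x, forall n, ksize k (incr f x) n.+1 <= b n x}.
Proof. by apply/(dominatesP _ _ f0); case: Ab. Qed.
Let sF n := filtration_sigma n hF.
Let FS n := @filtration_sub _ _ F n hF.

(** Increments of f stopped at [atom_time (m + 1)] minus f stopped at [atom_time m]: those with 2^m
    < b_i <= 2^(m+1) are kept. *)
Let band (m : int) i x : R := incr f x i * (lvl (m + 1) (b i x) - lvl m (b i x)).

Let lvl_set m i : F i [set x | b i x <= dyad R m].
Proof.
case: pb => _ _ mb; have := @mb i measurableT _ (measurable_itv `]-oo, dyad R m]).
by rewrite (measurable_g_sigmaE (sF i)) setTI.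
Qed.

Let lvlE m i x : lvl m (b i x) = \1_[set x | b i x <= dyad R m] x.
Proof.
rewrite indicE /lvl; congr (nat_of_bool _)%:R; apply/idP/idP => [h|/set_mem//].
exact/mem_set.
Qed.

Let measurable_lvl m i : measurable_wrt (F i) (fun x => lvl m (b i x)).
Proof.
under eq_fun do rewrite lvlE.
by apply: measurable_indic; rewrite (measurable_g_sigmaE (sF i)); exact: lvl_set.
Qed.

Let measurable_band m i : measurable_wrt (F i.+1) (band m i).
Proof.
apply: measurable_funM; first exact: (measurable_incr hF mf).
apply: measurable_funB.
  exact: (measurable_wrt_le hF (leqnSn i) (@measurable_lvl _ i)).
exact: (measurable_wrt_le hF (leqnSn i) (@measurable_lvl _ i)).
Qed.

Let integral_band m i A : F i A -> (\int[P]_(x in A) (band m i x)%:E = 0)%E.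
Proof.
move=> FA; have mA := FS FA.
have iI m' : P.-integrable A (EFin \o (fun x => incr f x i * lvl m' (b i x))).
  apply: (integrableS measurableT) => //.
  apply: le_integrable (integrable_incr mf i) => //.
    apply/measurable_EFinP/measurable_funM.
      by apply/measurable_EFinP; exact: measurable_int (integrable_incr mf i).
    exact: (measurable_wrtW (sF i) (@FS i) (@measurable_lvl m' i)).
  move=> x _ /=; rewrite lee_fin normrM ler_piMr// /lvl.
  by case: (b i x <= _); rewrite ?normr1 ?normr0.
under eq_integral do rewrite /band mulrBr.
rewrite integralB_EFin//.
under eq_integral do rewrite lvlE.
rewrite (integral_incr_indic hF mf FA (lvl_set _ i)) sub0e.
under eq_integral do rewrite lvlE.
by rewrite (integral_incr_indic hF mf FA (lvl_set _ i)) oppe0.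
Qed.

Let ksize_band_ae m : {ae P, forall x, forall n,
  ksize k (fun i => band m i x) n <= 4 * dyad R m}.
Proof.
apply: filterS fb => x fx n.
have -> : 4 * dyad R m = 2 * dyad R (m + 1) by rewrite dyadS mulrA -natrM.
apply: (ksize_band (b := fun i => b i x)) => //; first exact: ltW (dyad_gt0 _ _).
by rewrite le_dyad// lerDl.
Qed.

Let band_closed m : exists A : T -> R, P.-integrable setT (EFin \o A) /\
  forall n, is_cexp P (F n) A (fun x => \sum_(i < n) band m i x).
Proof.
have D0 : 0 <= 4 * dyad R m by rewrite mulr_ge0// ltW// dyad_gt0.
have D20 : 0 <= 2 * (4 * dyad R m) by rewrite mulr_ge0.
have D12 : 4 * dyad R m <= 2 * (4 * dyad R m) by rewrite ler_peMl// ler1n.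
(* Twice the size bound also controls single increments, so one constant serves all the
   hypotheses. *)
apply: (closed_martingale_ae (M := 2 * (4 * dyad R m)) hF (@measurable_band m)) => //.
- by move=> i; apply: filterS (ksize_band_ae m) => x; exact: increment_le_ksize.
- exact: integral_band.
case: k ksize_band_ae => H; [left | right] => n; apply: filterS (H m) => x /(_ n) /= h.
  have s0 : 0 <= \sum_(i < n) band m i x ^+ 2 by apply: sumr_ge0 => i _; exact: sqr_ge0.
  by rewrite -[leLHS]sqr_sqrtr// lerXn2r ?nnegrE ?sqrtr_ge0// (le_trans h).
exact: le_trans h _.
Qed.

Lemma band_terminal : exists A : int -> T -> R, forall m, P.-integrable setT (EFin \o A m) /\
  forall n, is_cexp P (F n) (A m) (fun x => \sum_(i < n) band m i x).
Proof. by have [A HA] := choice band_closed; exists A. Qed.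

Let A := sval (cid band_terminal).
Let iA m : P.-integrable setT (EFin \o A m).
Proof. by rewrite /A; case: cid => B /= /(_ m) []. Qed.
Let cA m n : is_cexp P (F n) (A m) (fun x => \sum_(i < n) band m i x).
Proof. by rewrite /A; case: cid => B /= /(_ m) []. Qed.

Definition atom_time m := first_hit b (dyad R m).
Let tP m : R := fine (P (stop_fin (atom_time m))) `^ p^-1.
(** The factor 4 2^m is the size bound of the band, so that division by the coefficient leaves
    exactly P(B)^(-1/p) when P(B) > 0. *)
Definition atom_coef m : R := 4 * dyad R m * tP m.
Definition atom_part m x : R := (atom_coef m)^-1 * A m x.

Let b_nd x m n : (m <= n)%N -> b m x <= b n x. Proof. exact: predictable_nd pb. Qed.

Let stop_finE m x : stop_fin (atom_time m) x <-> exists n, dyad R m < b n x.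
Proof. exact: stop_fin_first_hit. Qed.

Let stopping_atom_time m : stopping_time F (atom_time m).
Proof.
move=> n; rewrite first_hit_le//.
have -> : [set x | dyad R m < b n x] = ~` [set x | b n x <= dyad R m].
  by apply/seteqP; split=> x /=; rewrite ltNge => /negP.
rewrite -(measurable_g_sigmaE (sF n)); apply: measurableC.
by rewrite (measurable_g_sigmaE (sF n)).
Qed.

Let band_eq0 m i x : b i x <= dyad R m -> band m i x = 0.
Proof.
move=> bD; rewrite /band /lvl bD (le_trans bD) ?subrr ?mulr0//.
by rewrite le_dyad// lerDl.
Qed.

(** The cancellation survives a zero coefficient: in that case P(B) = 0, and outside B the whole
    band vanishes. *)
Let band_coefK m : {ae P, forall x, forall i,
  atom_coef m * ((atom_coef m)^-1 * band m i x) = band m i x}.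
Proof.
have [c0|c0] := eqVneq (atom_coef m) 0; last by apply: aeW => x i; rewrite mulVKf.
have P0 : P (stop_fin (atom_time m)) = 0%E.
  move/eqP : c0; rewrite mulf_eq0 gt_eqF/= ?mulr_gt0 ?dyad_gt0//.
  rewrite /tP powR_eq0 => /andP[/eqP z _].
  rewrite -[LHS]fineK ?z// fin_num_measure//.
  exact: (measurable_stop_fin hF (stopping_atom_time m)).
exists (stop_fin (atom_time m)); split => //.
  exact: (measurable_stop_fin hF (stopping_atom_time m)).
move=> x /= Hx; apply: contrapT => Sx; apply: Hx => i; rewrite band_eq0 ?mulr0//.
by rewrite leNgt; apply/negP => h; apply: Sx; apply/stop_finE; exists i.
Qed.

Let is_cexp_atom m n :
  is_cexp P (F n) (atom_part m) (fun x => (atom_coef m)^-1 * \sum_(i < n) band m i x).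
Proof.
have := is_cexp_lin (@FS n) (atom_coef m)^-1 0 (iA m) (iA m) (cA m n) (cA m n).
have E (W W' : T -> R) : (fun x => (atom_coef m)^-1 * W x + 0 * W' x) =
    (fun x => (atom_coef m)^-1 * W x) by apply/funext => x; rewrite mul0r addr0.
by rewrite !E.
Qed.

Let iatom m : P.-integrable setT (EFin \o atom_part m).
Proof. exact: (integrableZl measurableT (atom_coef m)^-1 (iA m)). Qed.

Let cexp_atom : {ae P, forall x, forall m n,
  cexp P (F n) (atom_part m) x = (atom_coef m)^-1 * \sum_(i < n) band m i x}.
Proof.
apply/ae_forall_int => m; apply/ae_foralln => n.
exact: (is_cexp_unique (sF n) (@FS n) (cexpP (sF n) (@FS n) (iatom m)) (is_cexp_atom m n)).
Qed.

Let band_coefKT : {ae P, forall x, forall m i,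
  atom_coef m * ((atom_coef m)^-1 * band m i x) = band m i x}.
Proof. exact/ae_forall_int. Qed.

Let atom_coef_ge0 m : 0 <= atom_coef m.
Proof. by rewrite mulr_ge0 ?powR_ge0// mulr_ge0// ltW// dyad_gt0. Qed.

Let incr_atom x m : (forall m n,
    cexp P (F n) (atom_part m) x = (atom_coef m)^-1 * \sum_(i < n) band m i x) ->
  mart_of P F (atom_part m) 0 x = 0 /\
  forall i, incr (mart_of P F (atom_part m)) x i = (atom_coef m)^-1 * band m i x.
Proof.
move=> Hx; split=> [|i]; first by rewrite /mart_of Hx big_ord0 mulr0.
by rewrite /incr /mart_of !Hx -mulrBr big_ord_recr/= addrAC subrr add0r.
Qed.

Lemma is_atom_part m : is_atom P F k p (atom_part m) (atom_time m).
Proof.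
split => //.
- move=> n; apply: filterS cexp_atom => x Hx sx; rewrite Hx big1 ?mulr0// => i _.
  by apply: band_eq0; exact: stop_ge_first_hit sx (ltn_ord i).
- have mS := measurable_stop_fin hF (stopping_atom_time m).
  rewrite poweRN ?fin_num_measure//.
  (* The norm of exponent [+oo] is an essential supremum when the total mass is positive and 0
     otherwise; both branches are closed. *)
  rewrite unlock; case: ifP => [_|_]; last by rewrite lee_fin invr_ge0 powR_ge0.
  apply/ess_supP; apply: filterS2 cexp_atom (ksize_band_ae m) => x Hx Kx.
  have [z0 ix] := incr_atom m Hx.
  rewrite /= gee0_abs; last first.
    apply: le_trans (ksize_le_atom_fun k 0 z0).
    by rewrite lee_fin ksize_ge0.
  apply: atom_fun_le => // n.
  rewrite (@eq_ksize _ _ _ (fun i => (atom_coef m)^-1 * band m i x)) => [|i _]; last exact: ix.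
  rewrite ksizeZ ger0_norm ?invr_ge0//.
  apply: (@le_trans _ _ ((atom_coef m)^-1 * (4 * dyad R m))).
    by rewrite ler_wpM2l ?invr_ge0.
  have D0 : 4 * dyad R m != 0 by rewrite gt_eqF// mulr_gt0// dyad_gt0.
  by rewrite /atom_coef invfM mulrAC mulVf// mul1r.
Qed.

(** The stopping time of index m is finite at x exactly when 2^m < b_oo(x), and the ratio of
    coefficient to P(B)^(1/p) is 4 2^m, so [dyadic_sum] applies at t = b_oo(x). *)
Lemma atom_sum_le eta x : 0 < eta ->
  (atom_sum P p eta atom_coef atom_time x <=
   (4 `^ eta * (1 - 2 `^ (- eta))^-1)%:E * seq_limit b x `^ eta)%E.
Proof.
move=> e0; rewrite EFinM -muleA.
have b_lim := seq_limit_ge0 x pb.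
apply: (@le_trans _ _ ((4 `^ eta)%:E * \esum_(m in [set: int])
    (if ((2 `^ m%:~R)%:E < seq_limit b x)%E then (2 `^ m%:~R `^ eta)%:E else 0))%E); last first.
  by apply: lee_wpmul2l; [rewrite lee_fin powR_ge0 | exact: dyadic_sum].
rewrite -esumZl ?powR_ge0//; last by move=> m; case: ifP => // _; rewrite lee_fin powR_ge0.
apply: le_esum => m _; rewrite indicE.
have [/set_mem/stop_finE [n Dn]|_] := boolP (x \in _); last first.
  rewrite mulr0 mule_ge0 ?lee_fin ?powR_ge0//.
  by case: ifP => // _; rewrite lee_fin powR_ge0.
rewrite -/(dyad R m) (_ : ((dyad R m)%:E < seq_limit b x)%E = true); last first.
  by apply: lt_le_trans (seq_limit_ge x n pb); rewrite lte_fin.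
rewrite mulr1 -EFinM lee_fin -powRM//; last exact: ltW (dyad_gt0 _ _).
have D0 : 0 <= 4 * dyad R m by rewrite mulr_ge0// ltW// dyad_gt0.
rewrite ge0_ler_powR ?nnegrE//; first exact: ltW.
- by rewrite divr_ge0// powR_ge0.
(* If P(B) = 0 the quotient is 0, as inversion sends 0 to 0. *)
rewrite /atom_coef /tP; have [->|t0] := eqVneq (fine (P (stop_fin (atom_time m))) `^ p^-1) 0.
  by rewrite invr0 mulr0.
by rewrite mulfK.
Qed.

Let mOm j : measurable (Om j). Proof. by case: hOm. Qed.
Let covOm : \bigcup_j Om j = setT. Proof. by case: hOm. Qed.
Let mlim : measurable_fun setT (seq_limit b). Proof. exact: (measurable_seq_limit hF pb). Qed.
Let blim : (amalgam_norm P Om p q (seq_limit b) < +oo)%E. Proof. by case: Ab => _ _ []. Qed.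
Let lim0 x : (0 <= seq_limit b x)%E. Proof. exact: seq_limit_ge0 x pb. Qed.

Let amalgam_atom_sum eta : 0 < eta ->
  (amalgam_norm P Om (p / eta) (q * (eta^-1)%:E) (atom_sum P p eta atom_coef atom_time) <=
   (4 `^ eta * (1 - 2 `^ (- eta))^-1)%:E * amalgam_norm P Om p q (seq_limit b) `^ eta)%E.
Proof.
move=> e0; have c0 := ltW (dyadic_const_gt0 e0).
rewrite -amalgam_norm_poweR//.
have qe0 : (0 < q * (eta^-1)%:E)%E by rewrite mule_gt0// lte_fin invr_gt0.
apply: le_amalgam_norm => //; first by rewrite divr_gt0.
- exact: (measurable_atom_sum P p hF).
- apply: measurable_funeM.
  apply: (@measurableT_comp _ _ _ _ _ _ (fun y : \bar R => y `^ eta)%E _ (seq_limit b)) => //.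
  exact: measurable_poweR.
- move=> x; rewrite !gee0_abs.
  + exact: atom_sum_le.
  + by rewrite mule_ge0// poweR_ge0.
  + by apply: esum_ge0 => m _; rewrite lee_fin mulr_ge0// powR_ge0.
Qed.

Lemma atomic_triplets_part : atomic_triplets P F Om k p q atom_coef atom_part atom_time.
Proof.
split => [m|m|eta /andP[e0 _]]; [exact: atom_coef_ge0 | exact: is_atom_part |].
split; first exact: (measurable_atom_sum P p hF).
apply: le_lt_trans (amalgam_atom_sum e0) _.
have fN : (amalgam_norm P Om p q (seq_limit b) `^ eta)%E \is a fin_num.
  by rewrite fin_num_poweR// ge0_fin_numE// amalgam_norm_ge0.
by rewrite -(fineK fN) -EFinM ltry.
Qed.

Lemma atomic_norm_part eta : 0 < eta ->
  (atomic_norm P Om p q eta atom_coef atom_time <=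
   ((4 `^ eta * (1 - 2 `^ (- eta))^-1) `^ eta^-1)%:E * amalgam_norm P Om p q (seq_limit b))%E.
Proof.
move=> e0; have c0 := ltW (dyadic_const_gt0 e0).
apply: (@le_trans _ _ (((4 `^ eta * (1 - 2 `^ (- eta))^-1)%:E *
    amalgam_norm P Om p q (seq_limit b) `^ eta) `^ eta^-1)%E).
  by apply: le_poweR; [rewrite invr_ge0 ltW | exact: amalgam_norm_ge0 | exact: amalgam_atom_sum].
by rewrite poweRM ?poweR_ge0// -poweRrM mulfV ?gt_eqF// poweRe1 ?amalgam_norm_ge0.
Qed.

Let zsum_band n lm x : zsum (fun m => \sum_(i < n) band m i x) lm =
  \sum_(i < n) incr f x i * (lvl (lm.2%:Z + 1) (b i x) - lvl (- lm.1%:Z) (b i x)).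
Proof.
rewrite /zsum exchange_big/=; apply: eq_bigr => i _.
rewrite -mulr_sumr; congr (_ * _).
exact: (zsum_telescope (fun m => lvl m (b i x)) lm).
Qed.

Lemma atomic_decomposition_part : atomic_decomposition P F atom_coef atom_part f.
Proof.
move=> n; apply: filterS3 (filterI f0 fb) cexp_atom band_coefKT => x [fx0 fbx] cx kx.
have ab i : b i x = 0 -> incr f x i = 0.
  by apply: (increment_eq0 (k := k) (b := fun i => b i x)).
have [N HN] := @band_eventually R (incr f x) (fun i => b i x) n (b0 ^~ x) ab.
have FF := two_sided_filter.
apply: (@cvg_trans _ ((fun _ : nat * nat => f n x) @ two_sided)); last exact: cvg_cst.
apply: near_eq_cvg; apply: two_sidedP; exists N => l m Nl Nm.
rewrite -(sum_incr n fx0).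
transitivity (zsum (fun m => \sum_(i < n) band m i x) (l, m)).
  by rewrite zsum_band; apply: eq_bigr => i _; rewrite HN.
rewrite /zsum; apply: eq_bigr => i _; rewrite cx mulrA mulr_sumr.
by apply: eq_bigr => j _; rewrite -mulrA kx.
Qed.

(** By telescoping, the partial sum from -l to m removes the increments with 2^-l < b_i <= 2^(m+1),
    and [ksize_remainder] controls the rest. The majorant has finite norm because it is at most 3
    b. *)
Lemma remainder_dominated l m : admissible P F Om k p q
  (fun n x => f n x - mart_of P F (fun y => zsum (fun i => atom_coef i * atom_part i y) (l, m)) n x)
  (fun n x => remainder_bound (dyad R (- l%:Z)) (dyad R (m%:Z + 1)) (b n x)).
Proof.
set u := dyad R (- l%:Z); set v := dyad R (m%:Z + 1).
have u0 : 0 <= u := ltW (dyad_gt0 _ _).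
have uv : u <= v by apply: le_dyad; lia.
have rb t : 0 <= t -> remainder_bound u v t <= 3 * t.
  move=> t0; rewrite /remainder_bound; case: ifP => // _.
  by rewrite ge_min ler_peMl// ler1n.
have pr := predictable_remainder u0 uv pb.
have cz : {ae P, forall x, forall n,
    mart_of P F (fun y => zsum (fun i => atom_coef i * atom_part i y) (l, m)) n x =
    \sum_(i < n) incr f x i * (lvl (m%:Z + 1) (b i x) - lvl (- l%:Z) (b i x))}.
  apply/ae_foralln => n.
  have [i1 c1] := is_cexp_sum (@FS n) (l + m).+1 (fun i => atom_coef (i%:Z - l%:Z))
    (fun i => iatom (i%:Z - l%:Z)) (fun i => is_cexp_atom (i%:Z - l%:Z) n).
  apply: filterS2 (is_cexp_unique (sF n) (@FS n) (cexpP (sF n) (@FS n) i1) c1) band_coefKT.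
  move=> x cx kx; rewrite /mart_of /zsum/= cx -(zsum_band n (l, m)) /zsum/=.
  apply: eq_bigr => i _; rewrite mulr_sumr mulr_sumr.
  by apply: eq_bigr => j _; rewrite kx.
split => //.
- apply/dominatesP.
    by apply: filterS2 f0 cz => x -> ->; rewrite big_ord0 subr0.
  apply: filterS2 fb cz => x fbx cx n.
  rewrite (@eq_ksize _ _ _ (fun i => incr f x i *
    (1 - ((b i x <= v)%R%:R - (b i x <= u)%R%:R)))); first exact: (ksize_remainder (b := fun i => b i x)).
  by move=> i _; rewrite /incr !cx big_ord_recr/= /lvl /incr; ring.
- have mr := measurable_seq_limit hF pr.
  split => //.
  apply: (@le_lt_trans _ _ (amalgam_norm P Om p q (fun x => 3%:E * seq_limit b x)%E)).
    apply: le_amalgam_norm => //; first exact: measurable_funeM.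
    move=> x; rewrite !gee0_abs ?mule_ge0 ?(seq_limit_ge0 _ pr)//.
    apply: (seq_limit_le pr) => n.
    apply: (@le_trans _ _ (3 * b n x)%:E); first by rewrite lee_fin rb.
    by rewrite EFinM lee_pmul2l//; exact: (seq_limit_ge x n pb).
  rewrite amalgam_normZ//.
  have fN : (amalgam_norm P Om p q (seq_limit b))%E \is a fin_num.
    by rewrite ge0_fin_numE// amalgam_norm_ge0.
  by rewrite -(fineK fN) -EFinM ltry.
Qed.

(** The majorant of the remainder decreases as l and m grow, so it suffices to treat l = m = N;
    there the limit [phi N] is dominated by 3 b_oo and tends to 0 almost surely. *)
Lemma atomic_convergence_part : (q < +oo)%E ->
  atomic_convergence P F Om k p q atom_coef atom_part f.
Proof.
move=> qy; have [r r0 qE] : exists2 r, 0 < r & q = r%:E.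
  by case: q q0 qy => [r| |]// r0 _; exists r.
pose phi N x := seq_limit (fun n x => remainder_bound (dyad R (- N%:Z)) (dyad R (N%:Z + 1)) (b n x)) x.
have uv (l m : nat) : dyad R (- l%:Z) <= dyad R (m%:Z + 1) by apply: le_dyad; lia.
have pr (l m : nat) := predictable_remainder (u := dyad R (- l%:Z)) (v := dyad R (m%:Z + 1))
  (ltW (dyad_gt0 _ _)) (uv l m) pb.
have FF := two_sided_filter.
rewrite /atomic_convergence; apply/cvge0P => [lm|e e0].
  by apply: le_ereal_inf_tmp => _ [c _ <-]; exact: amalgam_norm_ge0.
have phi3 N x : (0 <= phi N x <= 3%:E * seq_limit b x)%E.
  rewrite (seq_limit_ge0 _ (pr N N))/=.
  apply: (seq_limit_le (pr N N)) => n.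
  apply: (@le_trans _ _ (3 * b n x)%:E); last by rewrite EFinM lee_pmul2l//; exact: (seq_limit_ge x n pb).
  rewrite lee_fin /remainder_bound; case: ifP => // _.
  by rewrite ge_min ler_peMl// ler1n.
have := @amalgam_norm_cvg0 _ T R P Om mOm p r phi (fun x => 3%:E * seq_limit b x)%E p0 r0.
move=> H0; have [|||||N _ HN] := fun h1 h2 h3 h4 h5 => H0 h1 h2 h3 h4 h5 e e0.
- by move=> N; exact: (measurable_seq_limit hF (pr N N)).
- exact: measurable_funeM.
- exact: phi3.
- rewrite amalgam_normZ// -?qE//.
  have fN : (amalgam_norm P Om p q (seq_limit b))%E \is a fin_num.
    by rewrite ge0_fin_numE// amalgam_norm_ge0.
  by rewrite -(fineK fN) -EFinM ltry.
- apply: filterS (amalgam_norm_ae_lty mOm covOm p0 q0 mlim blim) => x.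
  rewrite gee0_abs// => bx; apply/cvge0P => [N|d0 d00]; first by case/andP: (phi3 N x).
  have fb' : seq_limit b x \is a fin_num by rewrite ge0_fin_numE.
  (* Once 2^N >= b_oo(x), the branch 3 b is never taken, and the other branch is at most 2^-N. *)
  have [M HM] := dyad_ge (fine (seq_limit b x)); have [L HL] := dyad_lt d00.
  exists (maxn M L) => // N /=; rewrite geq_max => /andP[MN LN].
  apply: (seq_limit_le (pr N N)) => n; rewrite lee_fin /remainder_bound.
  have bv : b n x <= dyad R (N%:Z + 1).
    apply: (@le_trans _ _ (dyad R N%:Z)); last by apply: le_dyad; rewrite lerDl.
    by apply: le_trans (HM N MN); rewrite -lee_fin fineK//; exact: (seq_limit_ge x n pb).
  by rewrite bv ge_min; apply/orP; right; rewrite ltW// HL.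
apply: two_sidedP; exists N => l m Nl Nm.
have := HN N (leqnn N); rewrite -qE; apply: le_trans.
apply: (@le_trans _ _ (amalgam_norm P Om p q
    (seq_limit (fun n x => remainder_bound (dyad R (- l%:Z)) (dyad R (m%:Z + 1)) (b n x))))).
  by apply: ereal_inf_lbound; eexists; [exact: remainder_dominated|].
apply: le_amalgam_norm => //.
- exact: (measurable_seq_limit hF (pr l m)).
- exact: (measurable_seq_limit hF (pr N N)).
- move=> x; have /andP[ph0 _] := phi3 N x.
  rewrite !gee0_abs ?(seq_limit_ge0 _ (pr l m))//.
  apply: (seq_limit_le (pr l m)) => n.
  apply: le_trans (seq_limit_ge x n (pr N N)).
  rewrite lee_fin /remainder_bound.
  have h1 : dyad R (- l%:Z) <= dyad R (- N%:Z) by apply: le_dyad; lia.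
  have h2 : dyad R (N%:Z + 1) <= dyad R (m%:Z + 1) by apply: le_dyad; lia.
  case: (leP (b n x) (dyad R (N%:Z + 1))) => hN.
    rewrite (le_trans hN h2) le_min ge_min lexx/= ge_min h1 orbT//.
  by case: ifP => // _; rewrite ge_min ler_peMl// ler1n.
Qed.

End decomposition.

(** * Part (ii): bounding a sum of atoms *)

Lemma ksize_sum (R : realType) (k : hardy_kind) (w : nat -> nat -> R) N n :
  ksize k (fun j => \sum_(i < N) w i j) n <= \sum_(i < N) ksize k (w i) n.
Proof.
elim: N => [|N IH].
  rewrite big_ord0 (@eq_ksize _ _ _ (fun j => 0 * 0)) => [|i _]; last by rewrite big_ord0 mul0r.
  by rewrite ksizeZ normr0 mul0r.
rewrite big_ord_recr/= -(@eq_ksize _ _ (fun j => \sum_(i < N) w i j + w N j)) => [|i _]; last first.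
  by rewrite big_ord_recr.
by rewrite (le_trans (ler_ksizeD _ _ _ _))// lerD2r.
Qed.

Lemma cvg_sum_ord (R : realType) (I : Type) (G : set_system I) (FG : Filter G)
    (u : I -> nat -> R) (a : nat -> R) n :
  (forall j, (fun i => u i j) @ G --> a j) ->
  (fun i => \sum_(j < n) u i j) @ G --> \sum_(j < n) a j.
Proof.
move=> ua; elim: n => [|n IH].
  by under eq_fun do rewrite big_ord0; rewrite big_ord0; exact: cvg_cst.
under eq_fun do rewrite big_ord_recr.
by rewrite big_ord_recr; exact: cvgD.
Qed.

Lemma cvg_ksize (R : realType) (I : Type) (G : set_system I) (FG : Filter G)
    (k : hardy_kind) (u : I -> nat -> R) (a : nat -> R) n :
  (forall j, (fun i => u i j) @ G --> a j) ->
  (fun i => ksize k (u i) n) @ G --> ksize k a n.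
Proof.
move=> ua; case: k => /=.
  apply: (@cvg_comp _ _ _ (fun i => \sum_(j < n) u i j ^+ 2) Num.sqrt); last exact: sqrt_continuous.
  apply: (@cvg_sum_ord R I G FG (fun i j => u i j ^+ 2) (fun j => a j ^+ 2) n) => j.
  by under eq_fun do rewrite expr2; rewrite expr2; exact: cvgM.
by apply: cvg_norm; exact: cvg_sum_ord.
Qed.

Lemma two_sided_proper : ProperFilter two_sided.
Proof. exact: filter_prod_proper. Qed.

Section synthesis.
Context d (T : measurableType d) (R : realType) (P : probability T R).
Variables (F : nat -> set (set T)) (Om : int -> set T).
Hypotheses (hF : filtration F) (hOm : amalgam_partition Om).
Variables (k : hardy_kind) (p : R) (q : \bar R) (f : nat -> T -> R).
Hypotheses (p0 : 0 < p) (q0 : (0 < q)%E) (mf : martingale0 P F f).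
Variables (lam : int -> R) (a : int -> T -> R) (nu : int -> T -> option nat).
Hypotheses (Htr : atomic_triplets P F Om k p q lam a nu)
  (Hdec : atomic_decomposition P F lam a f).

Let c i : R := lam i / (fine (P (stop_fin (nu i))) `^ p^-1).
Let S i n := [set x | exists2 m, nu i x = Some m & (m <= n)%N].
(** Candidate majorant: the scaled atom of index i contributes nothing as long as [nu i] > n, and at
    most [c i] afterwards. *)
Let s n x : \bar R := (\esum_(i in [set: int]) (c i * \1_(S i n) x)%:E)%E.

(* The running maximum of [fine (s n x)] equals [s n x] almost surely; since [fine +oo = 0],
   taking the maximum keeps it nondecreasing on the null set where [s] becomes infinite. *)
Let b := fix b n x : R := if n is m.+1 then Num.max (b m x) (fine (s n x)) else fine (s 0 x).

Let lam0 i : 0 <= lam i. Proof. by case: Htr. Qed.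
Let c0 i : 0 <= c i. Proof. by rewrite divr_ge0// powR_ge0. Qed.
Let snu i : stopping_time F (nu i). Proof. by case: Htr => _ /(_ i) []. Qed.
Let sF n := filtration_sigma n hF.

Let term_ge0 i n x : 0 <= c i * \1_(S i n) x. Proof. by rewrite mulr_ge0. Qed.

Let s_ge0 n x : (0 <= s n x)%E.
Proof. by apply: esum_ge0 => i _; rewrite lee_fin. Qed.

Let S_mono i m n : (m <= n)%N -> S i m `<=` S i n.
Proof. by move=> mn x [j nj jm]; exists j => //; exact: leq_trans jm mn. Qed.

Let s_nd m n x : (m <= n)%N -> (s m x <= s n x)%E.
Proof.
move=> mn; apply: le_esum => i _; rewrite lee_fin ler_wpM2l// !indicE ler_nat.
by case: (boolP (x \in S i m)) => // /set_mem/(S_mono mn) h; rewrite mem_set.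
Qed.

Let fine_le (y : \bar R) : (0 <= y)%E -> ((fine y)%:E <= y)%E.
Proof. by case: y => // r; rewrite leey. Qed.

Let b_le_s n x : ((b n x)%:E <= s n x)%E.
Proof.
elim: n => [|n IH] /=; first exact: fine_le.
rewrite EFin_max ge_max fine_le// andbT; apply: le_trans IH _; exact: s_nd.
Qed.

Let fine_s_le_b n x : fine (s n x) <= b n x.
Proof. by case: n => //= n; rewrite le_max lexx orbT. Qed.

Let measurable_s n : @measurable_fun _ _ (g_sigma_algebraType (F n)) _ setT (s n).
Proof.
apply: emeasurable_esum_int => [i x|i]; first by rewrite lee_fin.
apply/measurable_EFinP/measurable_funM; first exact: measurable_cst.
apply: measurable_indic; rewrite (measurable_g_sigmaE (sF n)); exact: snu.
Qed.

Let measurable_fine_s n : measurable_wrt (F n) (fun x => fine (s n x)).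
Proof.
apply: (@measurableT_comp _ _ _ (g_sigma_algebraType (F n)) _ _ fine _ (s n)); first exact: fine_measurable.
exact: measurable_s.
Qed.

Let pb : predictable_seq F b.
Proof.
split=> [n x|n x|n].
- by apply: le_trans (fine_s_le_b n x); rewrite fine_ge0.
- by rewrite /= le_max lexx.
- elim: n => [|n IH] /=; first exact: measurable_fine_s.
  apply: measurable_maxr; first exact: (measurable_wrt_le hF (leqnSn n) IH).
  exact: measurable_fine_s.
Qed.

(** Dropping the time restriction leaves an l^1 sum of the c_i over the i with x in B_{nu^i},
    bounded by the corresponding l^eta sum. *)
Let s_le_atom_sum n x eta : 0 < eta <= 1 -> (s n x <= atom_sum P p eta lam nu x `^ eta^-1)%E.
Proof.
move=> e01; have /andP[e0 _] := e01.
apply: (@le_trans _ _ (\esum_(i in [set: int]) (c i * \1_(stop_fin (nu i)) x)%:E)%E).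
  apply: le_esum => i _; rewrite lee_fin ler_wpM2l// !indicE ler_nat.
  case: (boolP (x \in S i n)) => // /set_mem [m nm _].
  by rewrite mem_set// /stop_fin/= nm.
apply: le_trans (esum_le_poweR e01 _) _ => [i|]; first by rewrite mulr_ge0.
apply: le_poweR; first by rewrite invr_ge0 ltW.
  by apply: esum_ge0 => i _; rewrite lee_fin powR_ge0.
apply: le_esum => i _; rewrite lee_fin indicE.
by case: (_ \in _); rewrite ?mulr1// !mulr0 powR0// gt_eqF.
Qed.

Let lim_le_atom_sum x eta : 0 < eta <= 1 ->
  (seq_limit b x <= atom_sum P p eta lam nu x `^ eta^-1)%E.
Proof.
move=> e01; apply: (seq_limit_le pb) => n.
exact: le_trans (b_le_s n x) (s_le_atom_sum n x e01).
Qed.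

Let mAS eta : measurable_fun setT (atom_sum P p eta lam nu).
Proof. exact: (measurable_atom_sum P p hF). Qed.

Let AS_ge0 eta x : (0 <= atom_sum P p eta lam nu x)%E.
Proof. by apply: esum_ge0 => i _; rewrite lee_fin mulr_ge0// powR_ge0. Qed.

Let mOm j : measurable (Om j). Proof. by case: hOm. Qed.
Let covOm : \bigcup_j Om j = setT. Proof. by case: hOm. Qed.

Let le_atomic_norm eta : 0 < eta <= 1 ->
  (amalgam_norm P Om p q (seq_limit b) <= atomic_norm P Om p q eta lam nu)%E.
Proof.
move=> e01; have /andP[e0 _] := e01.
have en0 : eta != 0 by rewrite gt_eqF.
pose g x := (atom_sum P p eta lam nu x `^ eta^-1)%E.
have mg : measurable_fun setT g.
  apply: (@measurableT_comp _ _ _ _ _ _ (fun y : \bar R => y `^ eta^-1)%E _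
    (atom_sum P p eta lam nu)) => //.
  exact: measurable_poweR.
have g0 x : (0 <= g x)%E by exact: poweR_ge0.
apply: (@le_trans _ _ (amalgam_norm P Om p q g)).
  apply: le_amalgam_norm => //; first exact: (measurable_seq_limit hF pb).
  by move=> x; rewrite !gee0_abs ?(seq_limit_ge0 _ pb)//; exact: lim_le_atom_sum.
have := amalgam_norm_poweR P mOm p0 q0 e0 ler01 mg g0.
have -> : (fun x => 1%:E * g x `^ eta)%E = atom_sum P p eta lam nu.
  by apply/funext => x; rewrite mul1e /g -poweRrM mulVf// poweRe1.
by rewrite /atomic_norm => ->; rewrite mul1e -poweRrM mulfV// poweRe1 ?amalgam_norm_ge0.
Qed.

Let ae_finite : {ae P, forall x, (atom_sum P p 1 lam nu x < +oo)%E}.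
Proof.
have e1 : 0 < (1 : R) <= 1 by rewrite ltr01 lexx.
case: Htr => _ _ /(_ 1 e1) [_ ].
move/(amalgam_norm_ae_lty mOm covOm _ _ (mAS 1)) => H.
have := H _ _; rewrite divr_gt0//= invr1 mule1 => /(_ isT q0).
by apply: filterS => x; rewrite gee0_abs.
Qed.

(** On {nu^i > n}, condition (a1) kills E_j a^i for all j <= n + 1, so the size at time n + 1 is 0;
    elsewhere (a2) bounds it by P(B)^(-1/p). *)
Let term_bound : {ae P, forall x, forall i n,
  lam i * ksize k (incr (mart_of P F (a i)) x) n.+1 <= c i * \1_(S i n) x}.
Proof.
apply/ae_forall_int => i; case: Htr => _ /(_ i) [_ _ H1 H2] _.
have mS := measurable_stop_fin hF (@snu i).
move: H2; rewrite poweRN ?fin_num_measure// unlock.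
case: ifP => [_|]; last by rewrite [X in (_ < X)%E]probability_setT lte01.
move=> /ess_supP H2; have {}H1 : {ae P, forall x, forall n, stop_ge (nu i) n x ->
    cexp P (F n) (a i) x = 0} by apply/ae_foralln.
apply: filterS2 H1 H2 => x h1 h2 n.
have z0 : mart_of P F (a i) 0 x = 0 by apply: h1.
rewrite indicE; have [xS|xS] := boolP (x \in S i n).
  rewrite mulr1 ler_wpM2l// -lee_fin; apply: le_trans (ksize_le_atom_fun k _ z0) _.
  by apply: le_trans h2; exact: lee_abs.
rewrite mulr0 (@eq_ksize _ _ _ (fun j => 0 * 0)) ?ksizeZ ?normr0 ?mul0r ?mulr0// => j jn.
have sg j' : (j' <= n.+1)%N -> stop_ge (nu i) j' x.
  move=> jn' m nm; rewrite (leq_trans jn')// ltnNge; apply/negP => mn.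
  by move/negP: xS; apply; apply/mem_set; exists m.
by rewrite /incr /mart_of !h1 ?subrr ?mulr0//; apply: sg => //; exact: ltnW.
Qed.

(** Subadditivity bounds the size of every partial sum by the same value [s n x]. For fixed n only
    finitely many increments enter, so the size passes to the limit along the two-sided partial
    sums. *)
Lemma synthesis_dominates : {ae P, forall x, forall n, ksize k (incr f x) n.+1 <= b n x}.
Proof.
have Hd : {ae P, forall x, forall n,
    zsum (fun i => lam i * cexp P (F n) (a i) x) @ two_sided --> f n x}.
  exact/ae_foralln.
have PF := two_sided_proper.
apply: filterS3 Hd ae_finite term_bound => x dx fx tx n.
apply: le_trans (fine_s_le_b n x).
have e1 : 0 < (1 : R) <= 1 by rewrite ltr01 lexx.
have sfin : s n x \is a fin_num.
  rewrite ge0_fin_numE//; apply: le_lt_trans (s_le_atom_sum n x e1) _.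
  by rewrite invr1 poweRe1.
pose u lm j := zsum (fun i => lam i * incr (mart_of P F (a i)) x j) lm.
have uE lm j : u lm j = zsum (fun i => lam i * cexp P (F j.+1) (a i) x) lm -
    zsum (fun i => lam i * cexp P (F j) (a i) x) lm.
  by rewrite /u /zsum -sumrB; apply: eq_bigr => i _; rewrite -mulrBr.
have cu : (fun lm => ksize k (u lm) n.+1) @ two_sided --> ksize k (incr f x) n.+1.
  apply: cvg_ksize => j; under eq_fun do rewrite uE.
  by apply: cvgB; exact: dx.
apply: (@ler_cvg_to _ _ _ _ (fun lm => ksize k (u lm) n.+1) (fun=> fine (s n x))) cu (cvg_cst _) _.
apply: nearW => lm; rewrite -lee_fin fineK//.
apply: (@le_trans _ _ (zsum (fun i => c i * \1_(S i n) x) lm)%:E); last exact: zsum_le_esum.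
rewrite lee_fin /u /zsum.
apply: le_trans (ksize_sum k (fun i j => lam (i%:Z - lm.1%:Z) *
  incr (mart_of P F (a (i%:Z - lm.1%:Z))) x j) _ _) _.
by apply: ler_sum => i _; rewrite ksizeZ ger0_norm.
Qed.

Lemma synthesis_admissible : admissible P F Om k p q f b.
Proof.
have f0 : {ae P, forall x, f 0%N x = 0} by case: mf.
split => //; first by apply/(dominatesP _ _ f0); exact: synthesis_dominates.
have e1 : 0 < (1 : R) <= 1 by rewrite ltr01 lexx.
split; first exact: (measurable_seq_limit hF pb).
apply: le_lt_trans (le_atomic_norm e1) _.
rewrite /atomic_norm; apply: poweR_lty.
by case: Htr => _ _ /(_ 1 e1) [].
Qed.

Lemma synthesis : hardy_space P F Om k p q f /\ forall eta, 0 < eta <= 1 ->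
  (hardy_norm P F Om k p q f <= atomic_norm P Om p q eta lam nu)%E.
Proof.
split=> [|eta e01]; first by split => //; exists b; exact: synthesis_admissible.
apply: le_trans (le_atomic_norm e01).
by apply: ereal_inf_lbound; exists b => //; exact: synthesis_admissible.
Qed.

End synthesis.
Unset Implicit Arguments.
Theorem theorem3p5 (R : realType) (p : R) (q : \bar R) (kind : hardy_kind)
    (hp : 0 < p) (hq : (0 < q)%E) :
  (exists C : R -> R,
    (forall eta, 0 < eta <= 1 -> 0 < C eta) /\
    forall (d : measure_display) (T : measurableType d) (P : probability T R)
      (F : nat -> set (set T)) (Om : int -> set T),
      filtration F -> amalgam_partition Om ->
      forall f : nat -> T -> R, hardy_space P F Om kind p q f ->
      exists (lam : int -> R) (a : int -> T -> R) (nu : int -> T -> option nat),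
        [/\ atomic_triplets P F Om kind p q lam a nu,
            atomic_decomposition P F lam a f,
            forall eta, 0 < eta <= 1 ->
              (atomic_norm P Om p q eta lam nu
                 <= (C eta)%:E * hardy_norm P F Om kind p q f)%E &
            (q < +oo)%E -> atomic_convergence P F Om kind p q lam a f]) /\
  (exists C : R -> R,
    (forall eta, 0 < eta <= 1 -> 0 < C eta) /\
    forall (d : measure_display) (T : measurableType d) (P : probability T R)
      (F : nat -> set (set T)) (Om : int -> set T),
      filtration F -> amalgam_partition Om ->
      forall (f : nat -> T -> R) (lam : int -> R) (a : int -> T -> R)
        (nu : int -> T -> option nat),
        martingale0 P F f ->
        atomic_triplets P F Om kind p q lam a nu ->
        atomic_decomposition P F lam a f ->
        hardy_space P F Om kind p q f /\
        forall eta, 0 < eta <= 1 ->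
          (hardy_norm P F Om kind p q f
             <= (C eta)%:E * atomic_norm P Om p q eta lam nu)%E).
Proof.
split.
(* 4^eta comes from the factor 4 in [atom_coef], the inverse is the sum of the geometric series, and
   the outer power is the one in the atomic norm. *)
- exists (fun eta => (4 `^ eta * (1 - 2 `^ (- eta))^-1) `^ eta^-1).
  split=> [eta /andP[e0 _]|d T P F Om hF hOm f [mf ex]].
    by rewrite powR_gt0// dyadic_const_gt0.
  have f0 : {ae P, forall x, f 0%N x = 0} by case: mf.
  (* One majorant has to serve every eta; a minimizer also covers the case of norm 0, where no
     near-minimizer up to a factor is guaranteed in advance. *)
  have [b Ab bN] := hardy_norm_attained hF hOm hp hq f0 ex.
  exists (atom_coef P p b), (atom_part hF mf Ab), (atom_time b); split.
  + exact: atomic_triplets_part.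
  + exact: atomic_decomposition_part.
  + move=> eta /andP[e0 _].
    apply: le_trans (atomic_norm_part hF hOm hp hq Ab e0) _.
    by rewrite lee_wpmul2l// lee_fin powR_ge0.
  + exact: atomic_convergence_part.
- exists (fun=> 1); split=> [//|d T P F Om hF hOm f lam a nu mf Htr Hdec].
  have [Hf Hn] := synthesis hF hOm hp hq mf Htr Hdec.
  by split=> // eta e01; rewrite mul1e; exact: Hn.
Qed.
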